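(* Let $\Bbbk$ be a field of characteristic $p>0$, let $S$ be a standard graded polynomial ring over $\Bbbk$ (in finitely many variables), and let $\mathfrak{p}_1,\ldots,\mathfrak{p}_m$ be nonzero homogeneous prime ideals of $S$ ($m\geq 1$). (1) If $\mathfrak{p}_1,\ldots,\mathfrak{p}_m$ satisfy conditions A and B, then for every real number $\lambda>0$ and every $\sigma\in\mathbb{N}^m$, \[\tau(\lambda\cdot I^{\sigma})=\bigcap_{k=1}^m\mathfrak{p}_k^{(\lfloor \lambda e_k(\sigma)\rfloor+1-\operatorname{ht}(\mathfrak{p}_k))}.\] (2) If $\mathfrak{p}_1,\ldots,\mathfrak{p}_m$ satisfy conditions A+ and B, then for every real number $\lambda>0$ and every subset $\Sigma\subseteq\mathbb{N}^m$, \[\tau(\lambda\cdot I(\Sigma))=\sum_{(v_1,\ldots,v_m)\in P_{\Sigma}}\left(\bigcap_{k=1}^m\mathfrak{p}_k^{(\lfloor \lambda v_k\rfloor+1-\operatorname{ht}(\mathfrak{p}_k))}\right).\]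
   Context: $\mathbb{N}$ includes $0$. For a prime $\mathfrak{p}$ of $S$ and $\ell\in\mathbb{N}$, $\mathfrak{p}^{(\ell)}=\mathfrak{p}^{\ell}S_{\mathfrak{p}}\cap S$ is the $\ell$-th symbolic power; $\mathfrak{p}^{(\ell)}=S$ for $\ell\leq 0$. $\operatorname{ht}$ denotes height and $\overline{I}$ denotes the integral closure of an ideal $I$. For $\sigma=(\sigma_1,\ldots,\sigma_m)\in\mathbb{N}^m$ put $I^{\sigma}:=\mathfrak{p}_1^{\sigma_1}\cdots\mathfrak{p}_m^{\sigma_m}$ and, for $k=1,\ldots,m$, $e_k(\sigma):=\max\{\ell\in\mathbb{N}: I^{\sigma}\subseteq\mathfrak{p}_k^{(\ell)}\}$; put $e(\sigma):=(e_1(\sigma),\ldots,e_m(\sigma))\in\mathbb{N}^m$. For $\Sigma\subseteq\mathbb{N}^m$ put $I(\Sigma):=\sum_{\sigma\in\Sigma}I^{\sigma}$, let $\overline{\Sigma}\subseteq\mathbb{Q}^m$ be the convex hull of $\Sigma$ in $\mathbb{Q}^m$ (finite convex combinations with rational coefficients), and let $P_{\Sigma}\subseteq\mathbb{Q}^m$ be the convex hull in $\mathbb{Q}^m$ of $\{e(\sigma):\sigma\in\Sigma\}$. For ${\bf v}=(v_1,\ldots,v_m)\in\mathbb{Q}^m$ put $\lceil{\bf v}\rceil:=(\lceil v_1\rceil,\ldots,\lceil v_m\rceil)$. Condition A: $\overline{I^{\sigma}}=\bigcap_{k=1}^m\mathfrak{p}_k^{(e_k(\sigma))}$ for all $\sigma\in\mathbb{N}^m$.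 Condition A+: $\overline{I(\Sigma)}=\sum_{{\bf v}\in\overline{\Sigma}}\left(\bigcap_{k=1}^m\mathfrak{p}_k^{(e_k(\lceil{\bf v}\rceil))}\right)$ for all $\Sigma\subseteq\mathbb{N}^m$. Condition B: there exists a polynomial $f\in\bigcap_{k=1}^m\mathfrak{p}_k^{\operatorname{ht}(\mathfrak{p}_k)}$ (ordinary powers) such that the initial monomial $\mathrm{in}_{\prec}(f)$ is a square-free monomial for some term order $\prec$ on $S$. Generalized test ideals: for an ideal $I\subseteq S$ and $e\in\mathbb{N}$, $I^{[p^e]}$ is the ideal generated by all $g^{p^e}$ with $g\in I$, and $I^{[1/p^e]}$ is the smallest ideal $J\subseteq S$ such that $I\subseteq J^{[p^e]}$ (it exists because the Frobenius is flat over $S$). For a real $\lambda>0$, the ideals $\bigl(I^{\lceil\lambda p^e\rceil}\bigr)^{[1/p^e]}$ form an ascending chain as $e$ increases, and the generalized test ideal of $I$ with coefficient $\lambda$ is its stable value: $\tau(\lambda\cdot I):=\bigl(I^{\lceil\lambda p^e\rceil}\bigr)^{[1/p^e]}$ for $e\gg 0$. *)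

(* Defs.v *)
From HB Require Import structures.
From mathcomp Require Import all_boot all_order all_algebra.
From mathcomp Require Import ring_quotient fraction archimedean.
From mathcomp Require Import boolp classical_sets reals.
From mathcomp Require Import mpoly.

Set Implicit Arguments.
Unset Strict Implicit.
Unset Printing Implicit Defensive.

Import Order.TTheory GRing.Theory Num.Theory.

Local Open Scope classical_set_scope.
Local Open Scope ring_scope.

(* The ideals of [ring_quotient] are proper; here the unit ideal is needed
   too, so ideals are plain sets closed under the ideal operations. *)

Section Ideals.
Variable A : comNzRingType.
Implicit Types (I J : set A) (G : set A).

Definition is_ideal I : Prop :=
  [/\ I 0, forall x y, I x -> I y -> I (x + y) & forall a x, I x -> I (a * x)].

Definition ideal_gen G : set A := smallest is_ideal G.

Definition ideal_sum (T : Type) (D : set T) (F : T -> set A) : set A :=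
  ideal_gen (\bigcup_(t in D) F t).

Definition ideal_mul I J : set A :=
  ideal_gen [set x | exists2 a, I a & exists2 b, J b & x = a * b].

Definition ideal_exp I (l : nat) : set A := iter l (ideal_mul I) setT.

Definition is_prime_ideal (P : set A) : Prop :=
  idealr_closed (mem P) /\ prime_idealr_closed (mem P).

(* f ^ n + a_1 f ^ (n - 1) + ... + a_n = 0 with a_i in I ^ i *)
Definition integral_closure I : set A :=
  [set f | exists n : nat, exists a : nat -> A,
     [/\ (0 < n)%N,
         forall i : nat, (1 <= i <= n)%N -> ideal_exp I i (a i) &
         f ^+ n + \sum_(1 <= i < n.+1) a i * f ^+ (n - i) = 0]].

End Ideals.

(* The value is meaningful only when the maximum exists (0 otherwise). *)
Definition nat_max (X : set nat) : nat :=
  xget 0%N [set l | X l /\ forall j, X j -> (j <= l)%N].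

Section Height.
Variable A : comNzRingType.

Definition prime_chain (P : set A) (h : nat) (Q : nat -> set A) : Prop :=
  [/\ forall i, (i <= h)%N -> is_prime_ideal (Q i),
      forall i, (i < h)%N -> Q i `<` Q i.+1 & Q h = P].

Definition height (P : set A) : nat :=
  nat_max [set h | exists Q, prime_chain P h Q].

End Height.

Section SymbolicPowers.
Variable A : idomainType.
Implicit Types P J : set A.

(* The extension J A_P of J to the localization A_P, inside Frac(A). *)
Definition loc_extension P J : set {fraction A} :=
  [set x | exists2 a, J a & exists2 s, ~ P s & x = tofrac a / tofrac s].

Definition loc_contraction (M : set {fraction A}) : set A :=
  [set f | M (tofrac f)].

Definition symbolic_power P (l : int) : set A :=
  match l with
  | Posz l => loc_contraction (loc_extension P (ideal_exp P l))
  | Negz _ => setT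
  end.

End SymbolicPowers.

Section TestIdeals.
Variables (A : comNzRingType) (p : nat).
Implicit Types I J : set A.

Definition frobenius_power I (e : nat) : set A :=
  ideal_gen [set x | exists2 g, I g & x = g ^+ (p ^ e)].

Definition frobenius_root I (e : nat) : set A :=
  smallest (fun J => is_ideal J /\ I `<=` frobenius_power J e) set0.

Definition is_stable_value (T : Type) (u : nat -> T) (x : T) : Prop :=
  exists e0 : nat, forall e : nat, (e0 <= e)%N -> u e = x.

(* The default value [set0], which is not an ideal, is irrelevant: over a
   polynomial ring of characteristic p the sequence is eventually constant. *)
Definition test_ideal (R : realType) (lambda : R) I : set A :=
  xget set0 [set J | is_stable_value
    (fun e => frobenius_root
       (ideal_exp I (absz (Num.ceil (lambda * (p ^ e)%:R)))) e) J].

End TestIdeals.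

Definition convex_hull (m : nat) (X : set 'rV[rat]_m) : set 'rV[rat]_m :=
  [set v | exists (r : nat) (c : 'I_r -> rat) (x : 'I_r -> 'rV[rat]_m),
     [/\ forall i, X (x i), forall i, 0 <= c i, \sum_i c i = 1 &
         v = \sum_i c i *: x i]].

Definition natQ (m : nat) (sigma : 'rV[nat]_m) : 'rV[rat]_m :=
  \row_k (sigma 0 k)%:R.

(* Used on vectors with nonnegative entries only. *)
Definition ceilQ (m : nat) (v : 'rV[rat]_m) : 'rV[nat]_m :=
  \row_k absz (Num.ceil (v 0 k)).

Section Primes.
Variables (A : idomainType) (m : nat) (P : 'I_m -> set A).

Definition Isigma (sigma : 'rV[nat]_m) : set A :=
  \big[@ideal_mul A/setT]_(k < m) ideal_exp (P k) (sigma 0 k).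

Definition esigma (sigma : 'rV[nat]_m) : 'rV[nat]_m :=
  \row_k nat_max [set l | Isigma sigma `<=` symbolic_power (P k) l%:Z].

Definition ISigma (Sigma : set 'rV[nat]_m) : set A := ideal_sum Sigma Isigma.

Definition PSigma (Sigma : set 'rV[nat]_m) : set 'rV[rat]_m :=
  convex_hull [set natQ (esigma sigma) | sigma in Sigma].

Definition conditionA : Prop :=
  forall sigma : 'rV[nat]_m,
    integral_closure (Isigma sigma) =
    \bigcap_(k : 'I_m) symbolic_power (P k) (esigma sigma 0 k)%:Z.

Definition conditionAplus : Prop :=
  forall Sigma : set 'rV[nat]_m,
    integral_closure (ISigma Sigma) =
    ideal_sum (convex_hull [set natQ sigma | sigma in Sigma])
      (fun v => \bigcap_(k : 'I_m)
         symbolic_power (P k) (esigma (ceilQ v) 0 k)%:Z).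

End Primes.

Section PolynomialRing.
Variables (K : fieldType) (n : nat).

Definition is_homogeneous (I : set {mpoly K[n]}) : Prop :=
  exists2 G : set {mpoly K[n]},
    (forall g, G g -> exists d, g \is d.-homog) & I = ideal_gen G.

Definition term_order (le : rel 'X_{1..n}) : Prop :=
  [/\ reflexive le /\ antisymmetric le, transitive le, total le,
      forall a, le 0%MM a &
      forall a b c, le a b -> le (a + c)%MM (b + c)%MM].

Definition is_initial_monomial (le : rel 'X_{1..n}) (f : {mpoly K[n]})
    (a : 'X_{1..n}) : Prop :=
  a \in msupp f /\ {in msupp f, forall b, le b a}.

Definition squarefree_monomial (a : 'X_{1..n}) : Prop :=
  forall i : 'I_n, (a i <= 1)%N.

Definition conditionB (m : nat) (P : 'I_m -> set {mpoly K[n]}) : Prop :=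
  exists f : {mpoly K[n]},
    (\bigcap_(k : 'I_m) ideal_exp (P k) (height (P k))) f /\
    exists le : rel 'X_{1..n}, term_order le /\
    exists a, is_initial_monomial le f a /\ squarefree_monomial a.

End PolynomialRing.

(* Main.v *)
(* Write q = p^e, h_k = ht p_k and N = ceil(lambda q).

   Upper bound.  Locally at p_k the ring is regular, so p_k is generated by h_k
   elements, and by pigeonhole p_k^(E) lies in (p_k^(l))^[q] as soon as
   E >= q (l + h_k - 1).  Flatness of Frobenius passes from the localization back
   to S and commutes with intersections.

   Lower bound.  If g lies in the right-hand side and f is as in condition B, then
   for q large g^q f^(q-1) vanishes along each p_k to order at least that of
   I^(N + mu), mu being the number of generators of I; condition A or A+ makes it
   integral over I^(N + mu), hence an element of I^N by Briancon-Skoda.  Since the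
   initial monomial of f is squarefree, some q-th root map sends f^(q-1) to 1, thus
   g^q f^(q-1) to g, and so I^N <= J^[q] forces g in J.

   The exponents e_k are additive because the order along p_k is a valuation, that
   is, because the graded ring of a regular local ring is a domain.  Flatness of
   Frobenius enters only through the additive maps phi with
   phi (a^q x) = a phi x: an element lies in J^[q] iff all of them send it to J. *)

Require Import Defs.
From HB Require Import structures.
From mathcomp Require Import all_boot all_order all_algebra.
From mathcomp Require Import fraction archimedean.
From mathcomp Require Import boolp classical_sets reals.
From mathcomp Require Import mpoly ring lra zify.

Set Implicit Arguments.
Unset Strict Implicit.
Unset Printing Implicit Defensive.

Import Order.TTheory GRing.Theory Num.Theory.
Local Open Scope classical_set_scope.
Local Open Scope ring_scope.

(** * Ideals *)

(** No localization is built: a statement about the local ring at P becomes a statement in S up to a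
    multiplier outside P, which is what [saturation] records. Root functionals fit this, since phi
    (t^q x) = t phi x turns a multiplier t^q into t.

    The field K may be infinite over K^p, so S need not be finite over S^q. This is why dual pairs
    are adapted to one element at a time and why the Frobenius of K is split by Zorn's lemma.

    Functionals sending a prescribed element to 1 serve beyond f^(q-1). Applied to a multiplier c
    with c h^k in J^k for all k, one of them removes c, which proves Briancon-Skoda in the manner of
    tight closure. Applied to an arbitrary x != 0, one bounds the order of x along P, in place of
    Krull's intersection theorem, so that the maxima defining e_k exist.

    Regularity and the bound on chains of primes are obtained by adjoining one variable at a time.
    Under A+ rational vectors are rounded up; by linearity of e_k this costs a constant independent
    of the power of I. *)

Section IdealTheory.
Variable A : comNzRingType.
Implicit Types (I J L : set A) (G : set A).

Lemma ideal_0 I : is_ideal I -> I 0. Proof. by case. Qed.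

Lemma ideal_add I x y : is_ideal I -> I x -> I y -> I (x + y).
Proof. by case=> _ + _; apply. Qed.

Lemma ideal_mull I a x : is_ideal I -> I x -> I (a * x).
Proof. by case=> _ _; apply. Qed.

Lemma ideal_mulr I a x : is_ideal I -> I x -> I (x * a).
Proof. by rewrite mulrC; exact: ideal_mull. Qed.

Lemma ideal_opp I x : is_ideal I -> I x -> I (- x).
Proof. by move=> idI Ix; rewrite -mulN1r; exact: ideal_mull. Qed.

Lemma ideal_sub I x y : is_ideal I -> I x -> I y -> I (x - y).
Proof. by move=> idI Ix Iy; apply: ideal_add => //; exact: ideal_opp. Qed.

Lemma ideal_bigsum (T : Type) (r : seq T) (Q : pred T) (F : T -> A) I :
  is_ideal I -> (forall i, Q i -> I (F i)) -> I (\sum_(i <- r | Q i) F i).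
Proof.
by move=> idI IF; apply: big_ind => //; [exact: ideal_0|move=> x y; exact: ideal_add].
Qed.

Lemma ideal_full I : is_ideal I -> I 1 -> forall x, I x.
Proof. by move=> idI I1 x; rewrite -(mulr1 x); exact: ideal_mull. Qed.

Lemma is_ideal_setT : is_ideal (@setT A). Proof. by split. Qed.

Lemma is_ideal_bigcap (T : Type) (D : set T) (F : T -> set A) :
  (forall i, D i -> is_ideal (F i)) -> is_ideal (\bigcap_(i in D) F i).
Proof.
move=> idF; split=> [i /idF/ideal_0 //|x y Ix Iy i Di|a x Ix i Di].
  by apply: ideal_add; [exact: idF|exact: Ix|exact: Iy].
by apply: ideal_mull; [exact: idF|exact: Ix].
Qed.

Lemma is_ideal_gen G : is_ideal (ideal_gen G).
Proof. by apply: is_ideal_bigcap => I []. Qed.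

Lemma ideal_gen_min I G : is_ideal I -> G `<=` I -> ideal_gen G `<=` I.
Proof. exact: smallest_sub. Qed.

Lemma ideal_gen_id I : is_ideal I -> ideal_gen I = I.
Proof. exact: smallest_id. Qed.

Lemma ideal_gen_mem G x : G x -> ideal_gen G x.
Proof. exact: sub_gen_smallest. Qed.

Lemma ideal_gen_mono G1 G2 : G1 `<=` G2 -> ideal_gen G1 `<=` ideal_gen G2.
Proof.
move=> s; apply: ideal_gen_min; first exact: is_ideal_gen.
by move=> x /s; exact: ideal_gen_mem.
Qed.

Lemma is_ideal_mul I J : is_ideal (ideal_mul I J).
Proof. exact: is_ideal_gen. Qed.

Lemma ideal_mul_mem I J a b : I a -> J b -> ideal_mul I J (a * b).
Proof. by move=> Ia Jb; apply: ideal_gen_mem; exists a => //; exists b. Qed.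

Lemma ideal_mul_min I J L : is_ideal L -> (forall a b, I a -> J b -> L (a * b)) ->
  ideal_mul I J `<=` L.
Proof.
by move=> idL sL; apply: ideal_gen_min => // _ [a Ia [b Jb ->]]; exact: sL.
Qed.

Lemma ideal_mul_mono I I' J J' : I `<=` I' -> J `<=` J' ->
  ideal_mul I J `<=` ideal_mul I' J'.
Proof.
move=> sI sJ; apply: ideal_mul_min; first exact: is_ideal_mul.
by move=> a b /sI ? /sJ ?; exact: ideal_mul_mem.
Qed.

Lemma ideal_mulC I J : ideal_mul I J = ideal_mul J I.
Proof.
apply/seteqP; split; apply: ideal_mul_min; try exact: is_ideal_mul;
  by move=> a b ? ?; rewrite mulrC; exact: ideal_mul_mem.
Qed.

Lemma is_ideal_colon I a : is_ideal I -> is_ideal [set x | I (a * x)].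
Proof.
move=> idI; split=> /= [|x y|b x]; first by rewrite mulr0; exact: ideal_0.
  by rewrite mulrDr; exact: ideal_add.
by rewrite mulrCA; exact: ideal_mull.
Qed.

Lemma ideal_mulA I J L :
  ideal_mul I (ideal_mul J L) = ideal_mul (ideal_mul I J) L.
Proof.
have half (X Y Z : set A) : ideal_mul X (ideal_mul Y Z) `<=` ideal_mul (ideal_mul X Y) Z.
  apply: ideal_mul_min; first exact: is_ideal_mul.
  move=> a x Xa YZx.
  suff: ideal_mul Y Z `<=` [set z | ideal_mul (ideal_mul X Y) Z (a * z)] by exact.
  apply: ideal_mul_min => [|b c Yb Zc /=]; first exact/is_ideal_colon/is_ideal_mul.
  by rewrite mulrA; apply: ideal_mul_mem => //; exact: ideal_mul_mem.
(* The reverse inclusion is [half] again, once commutativity has reversed all products. *)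
apply/seteqP; split; first exact: half.
by rewrite (ideal_mulC (ideal_mul I J)) (ideal_mulC I J) (ideal_mulC I) (ideal_mulC J L);
  exact: half.
Qed.

Lemma ideal_mulACA I J L M :
  ideal_mul (ideal_mul I J) (ideal_mul L M) =
  ideal_mul (ideal_mul I L) (ideal_mul J M).
Proof. by rewrite -!ideal_mulA (ideal_mulA J) (ideal_mulC J L) !ideal_mulA. Qed.

Lemma ideal_mulT I : is_ideal I -> ideal_mul I setT = I.
Proof.
move=> idI; apply/seteqP; split.
  by apply: ideal_mul_min => // a b Ia _; exact: ideal_mulr.
by move=> x Ix; rewrite -(mulr1 x); exact: ideal_mul_mem.
Qed.

Lemma is_ideal_exp I l : is_ideal (ideal_exp I l).
Proof. by case: l => [|l]; [exact: is_ideal_setT|exact: is_ideal_mul]. Qed.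
Hint Resolve is_ideal_exp is_ideal_mul is_ideal_gen is_ideal_setT : core.

Lemma ideal_expS I l : ideal_exp I l.+1 = ideal_mul I (ideal_exp I l).
Proof. by []. Qed.

Lemma ideal_exp1 I : is_ideal I -> ideal_exp I 1 = I.
Proof. exact: ideal_mulT. Qed.

Lemma ideal_expD I a b : ideal_exp I (a + b) = ideal_mul (ideal_exp I a) (ideal_exp I b).
Proof.
elim: a => [|a IH]; last by rewrite addSn !ideal_expS IH ideal_mulA.
by rewrite add0n ideal_mulC ideal_mulT.
Qed.

Lemma ideal_exp_mono I J l : I `<=` J -> ideal_exp I l `<=` ideal_exp J l.
Proof. by move=> sIJ; elim: l => // l IH; exact: ideal_mul_mono. Qed.

Lemma ideal_exp_le I a b : (a <= b)%N -> ideal_exp I b `<=` ideal_exp I a.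
Proof.
move=> /subnK <-; rewrite addnC ideal_expD.
by apply: ideal_mul_min => // x y Ix _; exact: ideal_mulr.
Qed.

Lemma ideal_exp_exp I a b : ideal_exp (ideal_exp I a) b = ideal_exp I (a * b)%N.
Proof. by elim: b => [|b IH]; rewrite ?muln0 // ideal_expS IH mulnS ideal_expD. Qed.

Lemma ideal_exp_mulmem I a b x y :
  ideal_exp I a x -> ideal_exp I b y -> ideal_exp I (a + b) (x * y).
Proof. by rewrite ideal_expD; exact: ideal_mul_mem. Qed.

Lemma ideal_exp_X I x k : I x -> ideal_exp I k (x ^+ k).
Proof. by move=> Ix; elim: k => // k IH; rewrite exprS; exact: ideal_mul_mem. Qed.

End IdealTheory.
#[global] Hint Resolve is_ideal_exp is_ideal_mul is_ideal_gen is_ideal_setT : core.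

(* [apply:] fails on the closure lemmas when [I] unfolds to an intersection, so
   [I] is read off the goal. *)
Ltac ideal_addT := match goal with |- ?I _ => refine (@ideal_add _ I _ _ _ _ _) end.
Ltac ideal_subT := match goal with |- ?I _ => refine (@ideal_sub _ I _ _ _ _ _) end.
Ltac ideal_mullT := match goal with |- ?I _ => refine (@ideal_mull _ I _ _ _ _) end.
Ltac ideal_mulrT := match goal with |- ?I _ => refine (@ideal_mulr _ I _ _ _ _) end.

(** * Saturations, symbolic powers and Frobenius powers *)

Section PrimeIdeals.
Variable A : comNzRingType.
Implicit Types (I J P : set A).

Lemma is_prime_idealP P : is_prime_ideal P <->
  [/\ is_ideal P, ~ P 1 & forall x y, P (x * y) -> P x \/ P y].
Proof.
rewrite /is_prime_ideal /idealr_closed /prime_idealr_closed; split.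
  move=> [[P0 P1 PD] PM]; rewrite !in_setE in P0 P1.
  split=> [||x y Pxy].
  - split=> // [x y Px Py|a x Px].
      by rewrite -(mul1r x) -in_setE PD // in_setE.
    by rewrite -(addr0 (a * x)) -in_setE PD // in_setE.
  - by move=> H; move/negP: P1; rewrite in_setE.
  - have := PM x y; rewrite !in_setE => /(_ Pxy)/orP[]; rewrite in_setE; by [left|right].
move=> [idP P1 PM]; split; first split.
- by rewrite in_setE; exact: ideal_0.
- by apply/negP; rewrite in_setE.
- move=> a u v; rewrite !in_setE => Pu Pv.
  by ideal_addT => //; by ideal_mullT.
- by move=> x y; rewrite !in_setE => /PM[] ?; apply/orP; rewrite !in_setE; [left|right].
Qed.

Lemma prime_ideal_exp P x k : is_prime_ideal P -> ~ P x -> ~ P (x ^+ k).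
Proof.
move=> /is_prime_idealP[idP P1 PM] nPx; elim: k => [|k IH]; first by rewrite expr0.
by rewrite exprS => /PM[].
Qed.

Lemma prime_ideal_mulN P x y : is_prime_ideal P -> ~ P x -> ~ P y -> ~ P (x * y).
Proof. by move=> /is_prime_idealP[_ _ PM] ? ? /PM[]. Qed.

(* The contraction to [A] of the extension of [I] to the localization at [P]. *)
Definition saturation P I : set A := [set x | exists2 s, ~ P s & I (s * x)].

Lemma is_ideal_saturation P I : is_prime_ideal P -> is_ideal I ->
  is_ideal (saturation P I).
Proof.
move=> primeP idI; have /is_prime_idealP[idP P1 PM] := primeP; split.
- by exists 1 => //; rewrite mulr0; exact: ideal_0.
- move=> x y [s Ps Isx] [t Pt Ity]; exists (s * t); first exact: prime_ideal_mulN.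
  rewrite mulrDr; ideal_addT => //; last by rewrite -mulrA; by ideal_mullT.
  by rewrite mulrAC; by ideal_mulrT.
- by move=> a x [s Ps Isx]; exists s => //; rewrite mulrCA; by ideal_mullT.
Qed.

Lemma saturation_sub P I : is_prime_ideal P -> I `<=` saturation P I.
Proof. by move=> /is_prime_idealP[_ P1 _] x Ix; exists 1; rewrite ?mul1r. Qed.

Lemma saturation_mono P I J : I `<=` J -> saturation P I `<=` saturation P J.
Proof. by move=> IJ x [s Ps /IJ ?]; exists s. Qed.

Lemma saturation_mulK P I s x : is_prime_ideal P -> ~ P s ->
  saturation P I (s * x) -> saturation P I x.
Proof.
move=> primeP Ps [t Pt Itsx]; exists (t * s); first exact: prime_ideal_mulN.
by rewrite -mulrA.
Qed.

Lemma saturationK P I : is_prime_ideal P ->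
  saturation P (saturation P I) `<=` saturation P I.
Proof. by move=> primeP x [s Ps]; exact: saturation_mulK. Qed.

Lemma saturation_mul P I J x y : is_prime_ideal P ->
  saturation P I x -> saturation P J y -> saturation P (ideal_mul I J) (x * y).
Proof.
move=> primeP [s Ps Isx] [t Pt Jty]; exists (s * t); first exact: prime_ideal_mulN.
by rewrite mulrACA; exact: ideal_mul_mem.
Qed.

Lemma saturation_exp P I J k : is_prime_ideal P ->
  I `<=` saturation P J -> ideal_exp I k `<=` saturation P (ideal_exp J k).
Proof.
move=> primeP IJ; elim: k => [|k IH]; first exact: saturation_sub.
apply: ideal_mul_min => [|x y Ix /IH Iy]; first exact: is_ideal_saturation.
by apply: saturation_mul => //; exact: IJ.
Qed.

End PrimeIdeals.

(** Clearing denominators: elements outside [P] are nonzero in the fraction field, so [f = a / s] is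
    the equation [s * f = a] in [A]. *)
Lemma symbolic_powerE (A : idomainType) (P : set A) (l : nat) :
  is_prime_ideal P -> symbolic_power P l%:Z = saturation P (ideal_exp P l).
Proof.
move=> primeP; have /is_prime_idealP[idP P1 _] := primeP.
have nz s : ~ P s -> (tofrac s : {fraction A}) != 0.
  by move=> Ps; rewrite tofrac_eq0; apply/eqP => s0; apply: Ps; rewrite s0; exact: ideal_0.
apply/seteqP; split=> f /=.
  move=> [a Pa [s Ps E]]; exists s => //; suff -> : s * f = a by [].
  by apply/eqP; rewrite -tofrac_eq rmorphM /= E mulrC divfK ?nz.
move=> [s Ps Psf]; exists (s * f) => //; exists s => //.
by rewrite rmorphM /= mulrC mulKf ?nz.
Qed.

Lemma is_ideal_symbolic_power (A : idomainType) (P : set A) (l : int) :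
  is_prime_ideal P -> is_ideal (symbolic_power P l).
Proof.
case: l => l primeP //; rewrite symbolic_powerE //.
exact: is_ideal_saturation.
Qed.

Section Generators.
Variable A : comNzRingType.
Implicit Types (s : seq A).

Definition gens s : set A := ideal_gen [set` s].

Lemma is_ideal_gens s : is_ideal (gens s). Proof. exact: is_ideal_gen. Qed.
Hint Resolve is_ideal_gens : core.

Lemma gens_min s (I : set A) : is_ideal I -> {in s, forall x, I x} -> gens s `<=` I.
Proof. by move=> idI sI; apply: ideal_gen_min => // x; exact: sI. Qed.

Lemma gens_mem s x : x \in s -> gens s x.
Proof. by move=> xs; exact: ideal_gen_mem. Qed.

Lemma gens_sub s t : {subset s <= t} -> gens s `<=` gens t.
Proof. by move=> st; apply: gens_min => // x /st; exact: gens_mem. Qed.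

Lemma gens_nil x : gens [::] x -> x = 0.
Proof.
apply: (@gens_min [::] [set y | y = 0]) => //.
by split=> //= [y z -> ->|a y ->]; rewrite ?addr0 ?mulr0.
Qed.

Lemma ideal_exp_gens_nil N x : (0 < N)%N -> ideal_exp (gens [::]) N x -> x = 0.
Proof.
case: N => // N _; apply: (@ideal_mul_min _ _ _ [set y | y = 0]).
  by split=> //= [y z -> ->|a y ->]; rewrite ?addr0 ?mulr0.
by move=> a b /gens_nil -> _ /=; rewrite mul0r.
Qed.

Lemma gens_cons y s x : gens (y :: s) x ->
  exists2 x0, gens s x0 & exists r, x = x0 + r * y.
Proof.
apply: (@gens_min _ [set x | exists2 x0, gens s x0 & exists r, x = x0 + r * y]).
  split=> /=.
  - by exists 0; [exact: ideal_0|exists 0; rewrite mul0r addr0].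
  - move=> _ _ [a0 ga [r ->]] [b0 gb [t ->]]; exists (a0 + b0);
      first exact: (ideal_add (is_ideal_gens s)).
    by exists (r + t); rewrite mulrDl addrACA.
  - move=> a _ [b0 gb [t ->]]; exists (a * b0);
      first exact: (ideal_mull _ (is_ideal_gens s)).
    by exists (a * t); rewrite mulrDr mulrA.
move=> z; rewrite inE => /orP[/eqP->|zs] /=.
  by exists 0; [exact: ideal_0|exists 1; rewrite mul1r add0r].
by exists z; [exact: gens_mem|exists 0; rewrite mul0r addr0].
Qed.

(** Singling out one generator allows induction on the list, both for the pigeonhole count and for
    graded rings. The coefficients [F] are not unique. *)
Lemma ideal_exp_gens_cons y s N x : ideal_exp (gens (y :: s)) N x ->
  exists2 F : nat -> A, forall i, (i <= N)%N -> ideal_exp (gens s) (N - i) (F i) &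
  x = \sum_(i < N.+1) F i * y ^+ i.
Proof.
elim: N x => [|N IH] x.
  by exists (fun=> x) => //; rewrite big_ord1 expr0 mulr1.
pose D M : set A := [set x | exists2 F : nat -> A,
  forall i, (i <= M)%N -> ideal_exp (gens s) (M - i) (F i) &
  x = \sum_(i < M.+1) F i * y ^+ i].
have idD M : is_ideal (D M).
  split.
  - exists (fun=> 0) => [i _|]; first exact: ideal_0.
    by rewrite big1 // => i _; rewrite mul0r.
  - move=> _ _ [F HF ->] [G HG ->]; exists (fun i => F i + G i).
      by move=> i iM; apply: (ideal_add (is_ideal_exp _ _)); [exact: HF|exact: HG].
    by rewrite -big_split; apply: eq_bigr => i _; rewrite /= mulrDl.
  - move=> a _ [F HF ->]; exists (fun i => a * F i).
      by move=> i iM; apply: (ideal_mull _ (is_ideal_exp _ _)); exact: HF.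
    by rewrite big_distrr; apply: eq_bigr => i _; rewrite /= mulrA.
(* In [a0 + r * y], the part [a0] raises the order of every coefficient by one, and [r * y] shifts
   the indices by one. *)
apply: (@ideal_mul_min _ _ _ (D N.+1)) => // a b /gens_cons[a0 ga0 [r ->]].
move=> /IH[F HF ->]; rewrite mulrDl; ideal_addT => //.
  exists (fun i => if (i <= N)%N then a0 * F i else 0).
    move=> i _; case: ifP => iN; last exact: ideal_0.
    by rewrite subSn //; apply: ideal_mul_mem => //; exact: HF.
  rewrite [RHS]big_ord_recr /= ltnn mul0r addr0 big_distrr; apply: eq_bigr => i _ /=.
  by rewrite -ltnS ltn_ord mulrA.
exists (fun i => if (0 < i)%N then r * F i.-1 else 0).
  case=> [|i] iN /=; first exact: ideal_0.
  by rewrite subSS; apply: (ideal_mull _ (is_ideal_exp _ _)); exact: HF.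
rewrite [RHS]big_ord_recl /= mul0r add0r big_distrr; apply: eq_bigr => i _ /=.
by rewrite /bump /= add1n /= exprS; ring.
Qed.

End Generators.
#[global] Hint Resolve is_ideal_gens : core.

Section Frobenius.
Variables (A : comNzRingType) (p : nat).
Implicit Types (I J : set A).

Lemma is_ideal_frobenius_power I e : is_ideal (frobenius_power p I e).
Proof. exact: is_ideal_gen. Qed.
Hint Resolve is_ideal_frobenius_power : core.

Lemma frobenius_power_mem I e x : I x -> frobenius_power p I e (x ^+ (p ^ e)).
Proof. by move=> Ix; apply: ideal_gen_mem; exists x. Qed.

Lemma frobenius_power_mono I J e : I `<=` J ->
  frobenius_power p I e `<=` frobenius_power p J e.
Proof. by move=> IJ; apply: ideal_gen_mono => _ [x /IJ Jx ->]; exists x. Qed.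

Lemma frobenius_power_full I e x : is_ideal I -> I 1 -> frobenius_power p I e x.
Proof.
move=> idI I1; apply: ideal_full => //.
by have := @frobenius_power_mem I e 1 I1; rewrite expr1n.
Qed.

Lemma frobenius_power_mul I J e x y : I x -> frobenius_power p J e y ->
  frobenius_power p (ideal_mul I J) e (x ^+ (p ^ e) * y).
Proof.
move=> Ix; apply: (@ideal_gen_min _
  [set z | frobenius_power p (ideal_mul I J) e (x ^+ (p ^ e) * z)]).
  exact: is_ideal_colon.
move=> _ [z Jz ->] /=; rewrite -exprMn; apply: frobenius_power_mem.
exact: ideal_mul_mem.
Qed.

(* Pigeonhole: a monomial of degree [N] in [size s] variables is a multiple of
   the [p ^ e]-th power of a monomial of degree [l]. *)
Lemma ideal_exp_sub_frobenius_power (s : seq A) l N e : (0 < p)%N ->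
  (p ^ e * l + size s * (p ^ e).-1 < N + p ^ e)%N ->
  ideal_exp (gens s) N `<=` frobenius_power p (ideal_exp (gens s) l) e.
Proof.
move=> p_gt0; have q_gt0 : (0 < p ^ e)%N by rewrite expn_gt0 p_gt0.
elim: s l N => [|y s IH] l N /=.
  case: l => [|l] H x Hx; first exact: frobenius_power_full.
  rewrite (ideal_exp_gens_nil _ Hx); first exact: ideal_0.
  by case: N H {Hx} => // ; rewrite mulnS; lia.
move=> H x /ideal_exp_gens_cons[F HF ->].
apply: ideal_bigsum => // i _.
have iN : (i <= N)%N by rewrite -ltnS.
have Ei := divn_eq i (p ^ e); have ri := ltn_pmod i q_gt0.
move: (i %/ p ^ e)%N (i %% p ^ e)%N Ei ri => j r Ei ri.
have gy : gens (y :: s) y by apply: gens_mem; rewrite inE eqxx.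
(* Either the power of [y] alone supplies [l] factors, or it supplies [j] of them and the remaining
   [l - j] come from [F i] by induction. *)
have [lj|jl] := leqP l j.
  rewrite Ei -(subnK lj) mulnDl addnAC exprD mulrA exprM; ideal_mullT => //.
  by apply: frobenius_power_mem; exact: ideal_exp_X.
have -> : F i * y ^+ i = y ^+ r * ((y ^+ j) ^+ (p ^ e) * F i).
  by rewrite Ei exprD exprM; ring.
ideal_mullT => //.
have -> : ideal_exp (gens (y :: s)) l =
    ideal_mul (ideal_exp (gens (y :: s)) j) (ideal_exp (gens (y :: s)) (l - j)).
  by rewrite -ideal_expD subnKC // ltnW.
apply: frobenius_power_mul; first exact: ideal_exp_X.
have sub : {subset s <= y :: s} by move=> z zs; rewrite inE zs orbT.
apply: frobenius_power_mono (IH (l - j)%N (N - i)%N _ _ (HF i iN)).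
  by apply: ideal_exp_mono; exact: gens_sub.
have E : (p ^ e * l = p ^ e * (l - j) + j * p ^ e)%N.
  by rewrite (mulnC j) -mulnDr subnK // ltnW.
move: H; rewrite E mulSn; move: iN Ei ri q_gt0.
move: (_ * (l - j))%N (j * _)%N (size s * _)%N => a b c; lia.
Qed.

End Frobenius.
#[global] Hint Resolve is_ideal_frobenius_power : core.

Section FrobeniusLinear.
Variable (A : comNzRingType).
Implicit Types (q : nat) (phi : A -> A).

Definition root_linear q phi : Prop :=
  (forall x y, phi (x + y) = phi x + phi y) /\
  (forall a x, phi (a ^+ q * x) = a * phi x).

(* [A] is generated by finitely many dual pairs over its [q]-th powers, as far
   as a given element is concerned: a substitute for a basis of [A] over [A^q]. *)
Definition has_root_duals q : Prop := forall x,
  exists (T : finType) (phi : T -> A -> A) (c : T -> A),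
  (forall j, root_linear q (phi j)) /\ x = \sum_j phi j x ^+ q * c j.

Lemma root_linear0 q phi : root_linear q phi -> phi 0 = 0.
Proof.
by move=> [phiD _]; apply: (addrI (phi 0)); rewrite -phiD !addr0.
Qed.

Lemma root_linear_mul q phi a : root_linear q phi -> root_linear q (fun x => phi (a * x)).
Proof.
by move=> [phiD phiM]; split=> [x y|b x]; rewrite ?mulrDr ?phiD // mulrCA phiM.
Qed.

Lemma root_linear_comp q q' phi psi : root_linear q phi -> root_linear q' psi ->
  root_linear (q' * q) (fun x => phi (psi x)).
Proof.
move=> [phiD phiM] [psiD psiM]; split=> [x y|b x]; first by rewrite psiD phiD.
by rewrite mulnC exprM psiM phiM.
Qed.

Lemma root_linear_frobenius_power p e (J : set A) x phi : is_ideal J ->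
  root_linear (p ^ e) phi -> frobenius_power p J e x -> J (phi x).
Proof.
(* All functionals are treated at once: closure under multiplication by [a] replaces [psi] by its
   composite with that multiplication. *)
move=> idJ phiL Jx; suff: forall psi, root_linear (p ^ e) psi -> J (psi x) by exact.
apply: (@ideal_gen_min _
  [set x | forall psi, root_linear (p ^ e) psi -> J (psi x)] _ _ _ x Jx).
  split=> /= [psi /root_linear0 ->|y z Jy Jz psi psiL|a y Jy psi psiL].
  - exact: ideal_0.
  - by rewrite psiL.1; ideal_addT => //; [exact: Jy|exact: Jz].
  - by apply: (Jy (fun x => psi (a * x))); exact: root_linear_mul.
move=> _ [g Jg ->] psi psiL /=; rewrite -(mulr1 (g ^+ _)) psiL.2.
by ideal_mulrT.
Qed.

(** The usable form of flatness: the condition on the right is visibly compatible with intersections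
    of ideals and with cancelling multipliers. *)
Lemma frobenius_powerP p e (J : set A) x : has_root_duals (p ^ e) -> is_ideal J ->
  frobenius_power p J e x <-> forall phi, root_linear (p ^ e) phi -> J (phi x).
Proof.
move=> duals idJ; split=> [Jx phi phiL|Jx]; first exact: root_linear_frobenius_power Jx.
have [T [phi [c [phiL ->]]]] := duals x; apply: ideal_bigsum => // j _.
by ideal_mulrT => //; apply: frobenius_power_mem; exact: Jx.
Qed.

End FrobeniusLinear.

(** * Hilbert's basis theorem *)

Definition noetherian (A : comNzRingType) : Prop :=
  forall I : set A, is_ideal I -> exists s : seq A, I = gens s.

Lemma gens_morph (A B : comNzRingType) (phi : {rmorphism A -> B}) (s : seq A) x :
  gens s x -> gens (map phi s) (phi x).
Proof.
apply: (@gens_min _ s [set y | gens (map phi s) (phi y)]).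
  split=> /= [|y z gy gz|a y gy].
  - by rewrite rmorph0; exact: ideal_0.
  - by rewrite rmorphD; ideal_addT.
  - by rewrite rmorphM; ideal_mullT.
by move=> y ys; apply: gens_mem; exact: map_f.
Qed.

Lemma is_ideal_preimage (A B : comNzRingType) (phi : {rmorphism A -> B}) (I : set B) :
  is_ideal I -> is_ideal (phi @^-1` I).
Proof.
move=> idI; split=> /= [|x y Ix Iy|a x Ix].
- by rewrite rmorph0; exact: ideal_0.
- by rewrite rmorphD; ideal_addT.
- by rewrite rmorphM; ideal_mullT.
Qed.

Lemma is_prime_ideal_preimage (A B : comNzRingType) (phi : {rmorphism A -> B})
  (P : set B) : is_prime_ideal P -> is_prime_ideal (phi @^-1` P).
Proof.
move=> /is_prime_idealP[idP P1 PM]; apply/is_prime_idealP; split.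
- exact: is_ideal_preimage.
- by rewrite /preimage /= rmorph1.
- by move=> x y; rewrite /preimage /= rmorphM; exact: PM.
Qed.

Section HilbertBasis.
Variable A : comNzRingType.
Implicit Types (I : set {poly A}) (f g : {poly A}).

(** Bounding the size instead of prescribing it admits [c = 0], which makes this set an ideal. *)
Let leads I d : set A := [set c | exists2 f, I f & (size f <= d.+1)%N /\ f`_d = c].

Lemma is_ideal_leads I d : is_ideal I -> is_ideal (leads I d).
Proof.
move=> idI.
split=> /=.
- by exists 0; [exact: ideal_0|rewrite size_poly0 coef0].
- move=> _ _ [f gf [sf <-]] [g gg [sg <-]]; exists (f + g); first by ideal_addT.
  rewrite coefD; split=> //; apply: leq_trans (size_polyD _ _) _.
  by rewrite geq_max sf.
- move=> a _ [f gf [sf <-]]; exists (a%:P * f); first by ideal_mullT.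
  rewrite coefCM; split=> //; rewrite mul_polyC.
  exact: leq_trans (size_scale_leq _ _) sf.
Qed.

Lemma gens_leads (t : seq {poly A}) d c : {in t, forall f, (size f <= d.+1)%N} ->
  gens [seq f`_d | f <- t] c ->
  exists2 g, gens t g & (size g <= d.+1)%N /\ g`_d = c.
Proof.
move=> szt; apply: (@gens_min _ _ (leads (gens t) d)); first exact: is_ideal_leads.
move=> _ /mapP[f ft ->]; exists f; [exact: gens_mem|by split; first exact: szt].
Qed.

Lemma noetherian_leads I d : noetherian A -> is_ideal I -> exists2 t : seq {poly A},
  {in t, forall f, I f} & forall f, I f -> (size f <= d.+1)%N ->
  exists2 g, gens t g & (size g <= d.+1)%N /\ g`_d = f`_d.
Proof.
move=> noethA idI.
have idL := is_ideal_leads d idI.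
have [s Ls] := noethA _ idL.
have [t [tI szt Es]] : exists t : seq {poly A}, [/\ {in t, forall f, I f},
    {in t, forall f, (size f <= d.+1)%N} & s = [seq f`_d | f <- t]].
  have : {in s, forall c, leads I d c} by move=> c cs; rewrite Ls; exact: gens_mem.
  elim: s {Ls} => [_|c s IH Hs]; first by exists [::].
  have [x xs|t [tI szt ->]] := IH; first by apply: Hs; rewrite inE xs orbT.
  have [f If [sf fd]] := Hs c (mem_head _ _).
  exists (f :: t); split; last by rewrite /= fd.
    by move=> x; rewrite inE => /orP[/eqP-> //|/tI].
  by move=> x; rewrite inE => /orP[/eqP-> //|/szt].
exists t => // f If sf; apply: gens_leads => //; rewrite -Es -Ls.
by exists f.
Qed.

Lemma noetherian_poly : noetherian A -> noetherian {poly A}.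
Proof.
move=> noethA I idI.
(* The ideals [leads I d] increase with [d], and the finitely many generators of their union all
   occur at some level [D]. *)
have [D HD] : exists D, forall d, leads I d `<=` leads I D.
  have mono d e : (d <= e)%N -> leads I d `<=` leads I e.
    move=> /subnK <- c [f If [sf fd]]; exists (f * 'X^(e - d)); first by ideal_mulrT.
    split; last by rewrite coefMXn ltnNge leq_addr /= addKn.
    apply: leq_trans (size_polyMleq _ _) _; rewrite size_polyXn addnS /=.
    by rewrite addnC -addnS leq_add2l.
  have idL : is_ideal (\bigcup_d leads I d).
    split=> /=.
    - by exists 0%N => //; exists 0; [exact: ideal_0|rewrite size_poly0 coef0].
    - move=> x y [d _ xd] [e _ ye]; exists (maxn d e) => //.
      exact: (ideal_add (is_ideal_leads _ idI) (mono _ _ (leq_maxl d e) _ xd)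
        (mono _ _ (leq_maxr d e) _ ye)).
    - move=> a x [d _ xd]; exists d => //.
      exact: (ideal_mull _ (is_ideal_leads _ idI)).
  have [s Ls] := noethA _ idL.
  have [D HD] : exists D, {in s, forall c, leads I D c}.
    have : {in s, forall c, (\bigcup_d leads I d) c}.
      by move=> c cs; rewrite Ls; exact: gens_mem.
    elim: s {Ls} => [_|c s IH Hs]; first by exists 0%N.
    have [x xs|D HD] := IH; first by apply: Hs; rewrite inE xs orbT.
    have [d _ Hd] := Hs c (mem_head _ _).
    exists (maxn d D) => x; rewrite inE => /orP[/eqP->|/HD].
      exact: (mono _ _ (leq_maxl d D)) Hd.
    exact: (mono _ _ (leq_maxr d D)).
  exists D => d c cd; have : (\bigcup_d leads I d) c by exists d.
  by rewrite Ls; apply: gens_min => //; exact: is_ideal_leads.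
have [T TI HT] : exists2 T : seq {poly A}, {in T, forall f, I f} &
    forall d, (d <= D)%N -> forall f, I f -> (size f <= d.+1)%N ->
    exists2 g, gens T g & (size g <= d.+1)%N /\ g`_d = f`_d.
  elim: (D) => [|E [T TI HT]].
    have [T TI HT] := noetherian_leads 0 noethA idI.
    by exists T => // d; rewrite leqn0 => /eqP ->.
  have [t tI Ht] := noetherian_leads E.+1 noethA idI.
  exists (t ++ T) => [f|d].
    by rewrite mem_cat => /orP[/tI|/TI].
  rewrite leq_eqVlt => /orP[/eqP->|dE] f If sf.
    have [g gg] := Ht f If sf; exists g => //; apply: gens_sub gg => z zt.
    by rewrite mem_cat zt.
  have [g gg] := HT d dE f If sf; exists g => //; apply: gens_sub gg => z zt.
  by rewrite mem_cat zt orbT.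
exists T; apply/seteqP; split; last exact: gens_min.
move=> f; have [N] := ubnP (size f); elim: N f => // N IH f szf If.
have [->|f0] := eqVneq f 0; first exact: ideal_0.
have sz1 : (0 < size f)%N by rewrite size_poly_gt0.
pose n := (size f).-1; have szn : size f = n.+1 by rewrite /n prednK.
suff [g [gg sg gn]] : exists g, [/\ gens T g, (size g <= n.+1)%N & g`_n = f`_n].
  have Ig : I g by apply: (gens_min idI) gg => z; exact: TI.
  rewrite -(subrK g f); ideal_addT => //; apply: IH; last by ideal_subT.
  apply: leq_trans (_ : n < N)%N; last by rewrite -szn.
  rewrite ltnS; apply/leq_sizeP => j; rewrite coefB leq_eqVlt => /orP[/eqP<-|nj].
    by rewrite gn subrr.
  by rewrite !nth_default ?subrr // (leq_trans _ nj) // szn.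
(* Beyond degree [D] the leading coefficient already occurs at level [D]; a power of ['X] lifts the
   polynomial found there. *)
have [nD|Dn] := leqP n D.
  by have [|g gg [sg gn]] := HT n nD f If _; rewrite ?szn //; exists g.
have [h Ih [sh hD]] : leads I D f`_n by apply: (HD n); exists f; rewrite ?szn.
have [g gg [sg gD]] := HT D (leqnn D) h Ih sh.
exists (g * 'X^(n - D)); split; first by ideal_mulrT.
  apply: leq_trans (size_polyMleq _ _) _; rewrite size_polyXn addnS /=.
  by rewrite (leq_trans (leq_add sg (leqnn _))) // addSn subnKC // ltnW.
by rewrite coefMXn ltnNge leq_subr /= subKn ?(ltnW Dn) // gD hD.
Qed.

End HilbertBasis.

(** * Regular chains of primes in polynomial extensions *)

(** [height] is a maximum with default value 0; a bound on all chains makes it a true maximum. *)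
Definition bounded_prime_chains (A : comNzRingType) : Prop :=
  exists B, forall P h (Q : nat -> set A), prime_chain P h Q -> (h <= B)%N.

Fixpoint prefix_gens (A : Type) (a : nat -> A) (i : nat) : seq A :=
  if i is j.+1 then a j :: prefix_gens a j else [::].

(* The localization at [P] is a regular local ring: [a 0, ..., a h.-1] generate
   its maximal ideal, and their initial segments generate a chain of primes. *)
Definition regular_chain (A : comNzRingType) (P : set A) (h : nat) (Q : nat -> set A)
  (a : nat -> A) : Prop :=
  [/\ prime_chain P h Q, forall i, (i < h)%N -> Q i.+1 (a i) &
      forall i, (i <= h)%N -> Q i `<=` saturation P (gens (prefix_gens a i))].

(** The invariant of the induction on the number of variables. *)
Definition regular_tower (A : comNzRingType) : Prop :=
  [/\ noetherian A, bounded_prime_chains A &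
      forall P : set A, is_prime_ideal P -> exists h Q a, regular_chain P h Q a].

Lemma prefix_gens_map (A B : Type) (f : A -> B) a i :
  prefix_gens (f \o a) i = map f (prefix_gens a i).
Proof. by elim: i => //= i ->. Qed.

Lemma eq_prefix_gens (A : Type) (a b : nat -> A) i :
  (forall j, (j < i)%N -> a j = b j) -> prefix_gens a i = prefix_gens b i.
Proof.
elim: i => //= i IH H; rewrite H // IH // => j ji; apply: H; exact: ltnW.
Qed.

Lemma size_prefix_gens (A : Type) (a : nat -> A) i : size (prefix_gens a i) = i.
Proof. by elim: i => //= i ->. Qed.

Lemma saturation_gens_morph (A B : comNzRingType) (phi : {rmorphism A -> B})
  (P : set B) (s : seq A) x :
  saturation (phi @^-1` P) (gens s) x -> saturation P (gens (map phi s)) (phi x).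
Proof.
by move=> [t Pt gtx]; exists (phi t) => //; rewrite -rmorphM; exact: gens_morph.
Qed.

Lemma prime_chain_preimage (A B : comNzRingType) (phi : {rmorphism A -> B})
  (P : set B) h Q : (forall y, exists x, phi x = y) -> prime_chain P h Q ->
  prime_chain (phi @^-1` P) h (fun i => phi @^-1` Q i).
Proof.
move=> phis [Qp Qs QP]; split=> [i /Qp|i /Qs [sub ne]|]; last by rewrite QP.
  exact: is_prime_ideal_preimage.
split=> [x|sub']; first exact: sub.
apply: ne => y Qy; have [x E] := phis y.
by rewrite -E; apply: (sub' x); rewrite /preimage /= E.
Qed.

Lemma regular_tower_iso (A B : comNzRingType) (phi : {rmorphism A -> B})
  (psi : {rmorphism B -> A}) : cancel phi psi -> cancel psi phi ->
  regular_tower A -> regular_tower B.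
Proof.
move=> phiK psiK [noethA [N bndA] regA].
have phis y : exists x, phi x = y by exists (psi y).
have psis y : exists x, psi x = y by exists (phi y).
split.
- move=> I idI; have [s Es] := noethA _ (is_ideal_preimage phi idI).
  exists (map phi s); apply/seteqP; split=> [x Ix|].
    rewrite -(psiK x); apply: gens_morph; rewrite -Es.
    by rewrite /preimage /= psiK.
  apply: gens_min => // _ /mapP[x xs ->]; change ((phi @^-1` I) x); rewrite Es.
  exact: gens_mem.
- exists N => P h Q /(prime_chain_preimage phis); exact: bndA.
- move=> P primeP.
  have [h [Q [a [chQ Qa Qsat]]]] := regA _ (is_prime_ideal_preimage phi primeP).
  exists h, (fun i => psi @^-1` Q i), (phi \o a); split.
  + have [H1 H2 H3] := prime_chain_preimage psis chQ; split=> //.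
    by rewrite H3; apply/seteqP; split=> x; rewrite /preimage /= psiK.
  + by move=> i ih; rewrite /preimage /= phiK; exact: Qa.
  + move=> i ih x /= Qx; rewrite prefix_gens_map -(psiK x).
    by apply: saturation_gens_morph; exact: Qsat.
Qed.

Lemma regular_tower_field (K : fieldType) : regular_tower K.
Proof.
have full (I : set K) x : is_ideal I -> I x -> x != 0 -> I = setT.
  move=> idI Ix x0; apply/seteqP; split=> // y _.
  by rewrite -(mulfVK x0 y); ideal_mullT.
have prime0 (P : set K) x : is_prime_ideal P -> P x -> x = 0.
  move=> /is_prime_idealP[idP P1 _] Px; apply/eqP/negPn/negP => x0.
  by apply: P1; rewrite (full P x).
split.
- move=> I idI; have [[x Ix x0]|H] := pselect (exists2 x, I x & x != 0).
    exists [:: 1]; rewrite (full I x) //; apply/seteqP; split=> // y _.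
    by rewrite -(mulr1 y); ideal_mullT => //; apply: gens_mem; rewrite inE.
  exists [::]; apply/seteqP; split=> [x Ix|x /gens_nil ->]; last exact: ideal_0.
  have [->|x0] := eqVneq x 0; first exact: ideal_0.
  by case: H; exists x.
- exists 0%N => P [|h] // Q [Qp Qs _]; have [_ ne] := Qs 0%N isT.
  case: ne => x /(prime0 _ _ (Qp 1%N isT)) ->.
  by have /is_prime_idealP[idQ _ _] := Qp 0%N isT; exact: ideal_0.
- move=> P primeP; exists 0%N, (fun=> P), (fun=> 0); split=> // i _ x /(prime0 _ _ primeP) ->.
  by apply: ideal_0; exact: is_ideal_saturation.
Qed.

Section PolynomialTower.
Variable A : idomainType.
Implicit Types (P Q X Y : set {poly A}) (q : set A).

(** For an ideal [q], this is the extended ideal q A[X]. *)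
Definition poly_extension q : set {poly A} := [set f | forall i, q f`_i].

Lemma is_ideal_poly_extension q : is_ideal q -> is_ideal (poly_extension q).
Proof.
move=> idq; split=> [i|f g Hf Hg i|f g Hg i].
- by rewrite coef0; exact: ideal_0.
- by rewrite coefD; ideal_addT.
- by rewrite coefM; apply: ideal_bigsum => // j _; ideal_mullT.
Qed.

Lemma poly_extensionC q c : is_ideal q -> poly_extension q c%:P <-> q c.
Proof.
move=> idq; split=> [/(_ 0%N)|qc i]; first by rewrite coefC.
by rewrite coefC; case: ifP => // _; exact: ideal_0.
Qed.

(** Gauss's argument: if i and j are the first indices at which f and g have a coefficient outside
    q, the coefficient of f g at i + j is f_i g_j modulo q. *)
Lemma is_prime_poly_extension q : is_prime_ideal q -> is_prime_ideal (poly_extension q).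
Proof.
move=> /is_prime_idealP[idq q1 qM]; have idE := is_ideal_poly_extension idq.
apply/is_prime_idealP; split=> // [/(_ 0%N)|f g fg]; first by rewrite coef1.
apply: contrapT => /not_orP[Nf Ng].
have minimal h : ~ poly_extension q h ->
    exists i, ~ q h`_i /\ forall j, (j < i)%N -> q h`_j.
  move=> /existsNP[i0 Hi0].
  have ex : exists i, `[< ~ q h`_i >] by exists i0; exact/asboolP.
  exists (ex_minn ex); case: ex_minnP => i /asboolP Hi Hm; split=> // j ji.
  by apply: contrapT => /asboolP/Hm; rewrite leqNgt ji.
have [i [fi Hi]] := minimal f Nf; have [j [gj Hj]] := minimal g Ng.
have := fg (i + j)%N; rewrite coefM.
have iij : (i < (i + j).+1)%N by rewrite ltnS leq_addr.
rewrite (bigD1 (Ordinal iij)) //= addKn => H.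
have : q (f`_i * g`_j).
  rewrite -[_ * _](addrK (\sum_(k < (i + j).+1 | k != Ordinal iij) f`_k * g`_(i + j - k))).
  ideal_subT => //; apply: ideal_bigsum => // k /eqP ki.
  have [ki'|ki'|ki'] := ltngtP k i.
  - by ideal_mulrT => //; exact: Hi.
  - by ideal_mullT => //; apply: Hj; move: (ltn_ord k); lia.
  - by case: ki; exact: val_inj.
by move=> /qM[].
Qed.

Lemma poly_extension_sub P : is_ideal P -> poly_extension (polyC @^-1` P) `<=` P.
Proof.
move=> idP f Hf; rewrite -[f]coefK poly_def; apply: ideal_bigsum => // i _.
by rewrite -mul_polyC; ideal_mulrT => //; exact: Hf.
Qed.

Lemma poly_extension_saturation P (s : seq A) q : is_prime_ideal P ->
  q `<=` saturation (polyC @^-1` P) (gens s) ->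
  poly_extension q `<=` saturation P (gens (map polyC s)).
Proof.
move=> primeP qs f Hf; have idS := is_ideal_saturation primeP (is_ideal_gens (map polyC s)).
rewrite -[f]coefK poly_def; apply: ideal_bigsum => // i _.
rewrite -mul_polyC; ideal_mulrT => //; apply: saturation_gens_morph; apply: qs; exact: Hf.
Qed.

(** [g] acts as a generator of [Y] over [X] after inverting constants. Were its leading coefficient
    in [X], removing the leading term would leave a smaller element of [Y], hence of [X], and [g]
    would lie in [X]. *)
Lemma minimal_size X Y f : is_ideal X -> is_ideal Y -> X `<=` Y -> Y f -> ~ X f ->
  exists g, [/\ Y g, ~ X g, ~ X (lead_coef g)%:P &
    forall k, Y k -> (size k < size g)%N -> X k].
Proof.
move=> idX idY XY Yf Xf.
have ex : exists n, `[< exists g, [/\ Y g, ~ X g & size g = n] >].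
  by exists (size f); apply/asboolP; exists f.
case: (ex_minnP ex) => n /asboolP[g [Yg Xg sg]] Hm.
have min k : Y k -> (size k < size g)%N -> X k.
  move=> Yk kg; apply: contrapT => Xk; move: kg; rewrite sg ltnNge Hm //.
  by apply/asboolP; exists k.
exists g; split=> // Xl; apply: Xg.
have g0 : g != 0 \/ g = 0 by have [->|] := eqVneq g 0; [right|left].
case: g0 => [g0|->]; last exact: ideal_0.
have Xt : X (lead_coef g *: 'X^((size g).-1)) by rewrite -mul_polyC; ideal_mulrT.
rewrite -(subrK (lead_coef g *: 'X^((size g).-1)) g); ideal_addT => //; apply: min.
  by ideal_subT => //; exact: XY.
have sz : (0 < size g)%N by rewrite size_poly_gt0.
rewrite -[ltnRHS](prednK sz) ltnS; apply/leq_sizeP => j.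
rewrite coefB coefZ coefXn leq_eqVlt => /orP[/eqP<-|jg].
  by rewrite eqxx mulr1 subrr.
by rewrite gtn_eqF // mulr0 subr0 nth_default // -(prednK sz).
Qed.

Lemma pseudo_division f g : exists (k : nat) (u r : {poly A}),
  (lead_coef g)%:P ^+ k * f = u * g + r /\ (g != 0 -> (size r < size g)%N) /\
  (g != 0 -> size u = (size f - (size g).-1)%N).
Proof.
exists (scalp f g), (f %/ g), (f %% g); split.
  by rewrite -Pdiv.WeakIdomain.divp_eq -polyC_exp mul_polyC.
by split=> g0; rewrite ?ltn_modp ?size_divp.
Qed.

(** Over a field of fractions this says that dimension grows by at most one. Minimal elements f of
    Q1 outside Q0 and g of Q2 outside Q1 are divided by each other, the larger by the smaller; the
    remainder is too small to lie outside the lower prime, and primality cancels the power of the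
    leading coefficient. *)
Lemma poly_prime_chain3 Q0 Q1 Q2 :
  is_prime_ideal Q0 -> is_prime_ideal Q1 -> is_prime_ideal Q2 ->
  Q0 `<` Q1 -> Q1 `<` Q2 -> ~ (polyC @^-1` Q2 `<=` polyC @^-1` Q0).
Proof.
move=> /is_prime_idealP[id0 n0 M0] /is_prime_idealP[id1 n1 M1].
move=> /is_prime_idealP[id2 n2 M2] [s01 ne01] [s12 ne12] H.
have X0 (Q : set {poly A}) (l : {poly A}) k : ~ Q 1 -> (forall x y, Q (x * y) -> Q x \/ Q y) ->
    forall x, ~ Q l -> Q (l ^+ k * x) -> Q x.
  move=> nQ MQ x Ql; elim: k => [|k IH]; first by rewrite mul1r.
  by rewrite exprS -mulrA => /MQ[].
have [f' Qf' Nf'] : exists2 f, Q1 f & ~ Q0 f.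
  by apply: contrapT => E; apply: ne01 => x Qx; apply: contrapT => Nx; apply: E; exists x.
have [g' Qg' Ng'] : exists2 f, Q2 f & ~ Q1 f.
  by apply: contrapT => E; apply: ne12 => x Qx; apply: contrapT => Nx; apply: E; exists x.
have [f [Q1f Q0f Q0l fmin]] := minimal_size id0 id1 s01 Qf' Nf'.
have [g [Q2g Q1g Q1l gmin]] := minimal_size id1 id2 s12 Qg' Ng'.
have Nf0 : f != 0 by apply/eqP => E; apply: Q0f; rewrite E; exact: ideal_0.
have Ng0 : g != 0 by apply/eqP => E; apply: Q1g; rewrite E; exact: ideal_0.
have sg : (1 < size g)%N.
  rewrite ltnNge; apply/negP => /size1_polyC E; apply: Q1g; rewrite E.
  by apply: s01; apply: H; rewrite /preimage /= -E.
have [gf|fg] := leqP (size g) (size f).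
  have [k [u [r [E [/(_ Ng0) sr /(_ Ng0) su]]]]] := pseudo_division f g.
  have Er : r = (lead_coef g)%:P ^+ k * f - u * g by rewrite E addrC addKr.
  have Q1r : Q1 r.
    apply: gmin sr; rewrite Er; ideal_subT => //; ideal_mullT => //; exact: s12.
  have Q0r : Q0 r by apply: fmin => //; exact: leq_trans sr gf.
  have Q1u : Q1 u.
    have : Q1 (u * g).
      rewrite -(addrK r (u * g)) -E; ideal_subT => //; by ideal_mullT.
    by case/M1.
  have Q0u : Q0 u.
    by apply: fmin => //; rewrite su; move: sg gf; clear; move: (size g) (size f); lia.
  apply: Q0f; apply: (X0 Q0 (lead_coef g)%:P k) => //; first by move=> /s01.
  by rewrite E; ideal_addT => //; ideal_mulrT.
have [k [u [r [E [/(_ Nf0) sr _]]]]] := pseudo_division g f.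
have Q2r : Q2 r.
  have -> : r = (lead_coef f)%:P ^+ k * g - u * f by rewrite E addrC addKr.
  by ideal_subT => //; ideal_mullT => //; exact: s12.
have Q1r : Q1 r by apply: gmin => //; exact: ltn_trans fg.
apply: Q1g; apply: (X0 Q1 (lead_coef f)%:P k) => //.
  by move=> /s12 /H.
by rewrite E; ideal_addT => //; ideal_mullT.
Qed.

(** Contraction to [A] is strict along every second prime, so a chain of length 2N + 2 would give
    one of length N + 1 in [A]. The bound is crude, but any bound will do. *)
Lemma bounded_prime_chains_poly : bounded_prime_chains A -> bounded_prime_chains {poly A}.
Proof.
move=> [N HN]; exists (N.*2.+1) => P h Q [Qp Qs _].
rewrite leqNgt; apply/negP => hN.
suff : prime_chain (polyC @^-1` Q N.+1.*2) N.+1 (fun i => polyC @^-1` Q i.*2).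
  by move/HN; rewrite ltnn.
have le2 i : (i <= N.+1)%N -> (i.*2 <= h)%N by rewrite -leq_double => /leq_trans; apply; rewrite doubleS.
split=> // i iN; first exact: (is_prime_ideal_preimage polyC (Qp _ (le2 _ iN))).
have lt2 : (i.*2.+1 < h)%N by have := le2 i.+1 iN; rewrite doubleS.
have s1 := Qs _ (ltnW lt2); have s2 := Qs _ lt2; rewrite doubleS; split.
  by move=> x; rewrite /preimage /= => Hx; apply: s2.1; exact: s1.1.
exact: (poly_prime_chain3 (Qp _ (ltnW (ltnW lt2))) (Qp _ (ltnW lt2)) (Qp _ lt2) s1 s2).
Qed.

Lemma regular_tower_poly : regular_tower A -> regular_tower {poly A}.
Proof.
move=> [noethA bndA regA]; split.
- exact: noetherian_poly.
- exact: bounded_prime_chains_poly.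
move=> P primeP; have /is_prime_idealP[idP P1 PM] := primeP.
have primep := is_prime_ideal_preimage polyC primeP.
have [h [Q [a [[Qp Qs Qh] Qa Qsat]]]] := regA _ primep.
have Esub : poly_extension (polyC @^-1` P) `<=` P by exact: poly_extension_sub.
have Es i : (i < h)%N -> poly_extension (Q i) `<` poly_extension (Q i.+1).
  move=> ih; have [sub ne] := Qs i ih; split=> [f Hf j|E]; first exact/sub/Hf.
  apply: ne => x Qx.
  have /is_prime_idealP[id1 _ _] := Qp i (ltnW ih).
  have /is_prime_idealP[id2 _ _] := Qp i.+1 ih.
  by apply/(poly_extensionC _ id1); apply: E; exact/poly_extensionC.
(* Either [P] is extended from its contraction and the chain is extended with it, or [P] lies
   strictly above that extension and the chain gains one step, with a polynomial of minimal size as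
   last generator. *)
have [PE|] := pselect (P `<=` poly_extension (polyC @^-1` P)).
  exists h, (fun i => poly_extension (Q i)), (polyC \o a); split.
  - split=> // [i /Qp|]; first exact: is_prime_poly_extension.
    by rewrite Qh; apply/seteqP.
  - move=> i ih; apply/poly_extensionC; last exact: Qa.
    by have /is_prime_idealP[] := Qp _ ih.
  - move=> i ih; rewrite prefix_gens_map.
    by apply: poly_extension_saturation => //; exact: Qsat.
move=> /existsNP[f0 /not_implyP[Pf0 Nf0]].
have /is_prime_idealP[idp _ _] := primep.
have [f [Pf Nf Nl fmin]] := minimal_size (is_ideal_poly_extension idp) idP Esub Pf0 Nf0.
have f_neq0 : f != 0.
  by apply/eqP => E; apply: Nf; rewrite E; apply: ideal_0; exact: is_ideal_poly_extension.
pose b i := if (i < h)%N then (a i)%:P else f.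
have Eb i : (i <= h)%N -> prefix_gens b i = map polyC (prefix_gens a i).
  rewrite -prefix_gens_map => ih; apply: eq_prefix_gens => j ji.
  by rewrite /b (leq_trans ji ih).
exists h.+1, (fun i => if (i <= h)%N then poly_extension (Q i) else P), b; split.
- split=> [i _|i|]; last by rewrite ltnn.
    by case: ifP => // /Qp; exact: is_prime_poly_extension.
  rewrite ltnS leq_eqVlt => /orP[/eqP->|ih]; last by rewrite ih orbT; exact: Es.
  rewrite eqxx ltnn Qh; split=> // E; apply: Nf; exact: E.
- move=> i; rewrite /b ltnS leq_eqVlt => /orP[/eqP->|ih]; first by rewrite ltnn.
  rewrite ih; apply/poly_extensionC; last exact: Qa.
  by have /is_prime_idealP[] := Qp _ ih.
move=> i; rewrite leq_eqVlt ltnS => /orP[/eqP->|ih]; last first.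
  by rewrite ih Eb //; apply: poly_extension_saturation => //; exact: Qsat.
rewrite ltnn => g Pg.
have idS := is_ideal_saturation primeP (is_ideal_gens (prefix_gens b h.+1)).
(* The remainder lies in [P] and is smaller than [f], hence is extended from [A]. The multiplier, a
   power of the leading coefficient of [f], lies outside [P] and disappears under saturation. *)
have [k [u [r [E [/(_ f_neq0) sr _]]]]] := pseudo_division g f.
have Pr : P r.
  have -> : r = (lead_coef f)%:P ^+ k * g - u * f by rewrite E addrC addKr.
  by ideal_subT => //; ideal_mullT.
have Nlk : ~ P ((lead_coef f)%:P ^+ k).
  apply: prime_ideal_exp => // Pl; apply: Nl; exact/poly_extensionC.
apply: (saturation_mulK primeP Nlk); rewrite E; ideal_addT => //.
  ideal_mullT => //; apply: saturation_sub => //; apply: gens_mem.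
  by rewrite /= /b ltnn mem_head.
have /(poly_extension_saturation primeP (Qsat h (leqnn h))) : poly_extension (Q h) r.
  by rewrite Qh; exact: fmin.
apply: saturation_mono; apply: gens_sub => x; rewrite -Eb // inE => ->.
by rewrite orbT.
Qed.

End PolynomialTower.

(** * Splitting the Frobenius of a field *)

Lemma sum_option (V : nmodType) (T : finType) (F : option T -> V) :
  \sum_j F j = F None + \sum_t F (Some t).
Proof.
rewrite (bigD1 None) //=; congr (_ + _).
rewrite (reindex_omap Some id) /=; last by case=> [t|].
by apply: eq_bigl => t; rewrite eqxx.
Qed.

Section FrobeniusSplitting.
Variables (K : fieldType) (p : nat).
Hypothesis charK : p \in [pchar K].

Lemma exprDp e (x y : K) : (x + y) ^+ (p ^ e) = x ^+ (p ^ e) + y ^+ (p ^ e).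
Proof.
rewrite exprDn_pchar // pnatX; apply/orP; left.
by rewrite pnatE // (pcharf_prime charK).
Qed.

(* A complement of the line [K^p] in [K] is a maximal [K^p]-subspace avoiding 1. *)
Lemma frobenius_splitting : exists psi : K -> K, root_linear p psi /\ psi 1 = 1.
Proof.
have pD (x y : K) : (x + y) ^+ p = x ^+ p + y ^+ p by have := exprDp 1 x y; rewrite expn1.
have p_gt0 : (0 < p)%N := prime_gt0 (pcharf_prime charK).
have pN (x : K) : (- x) ^+ p = - x ^+ p.
  by apply: (addrI (x ^+ p)); rewrite -pD !subrr expr0n gtn_eqF.
pose sub (W : set K) := [/\ forall x y, W x -> W y -> W (x + y),
  forall a x, W x -> W (a ^+ p * x) & ~ W 1].
have [|W [[WD WM W1] Wmax]] := @Zorn_bigcup K sub.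
  move=> F Fsub Ftot; split.
  - move=> x y [X FX Xx] [Y FY Yy].
    have [XY|YX] := Ftot _ _ FX FY.
      by exists Y => //; have [YD _ _] := Fsub _ FY; apply: YD => //; exact: XY.
    by exists X => //; have [XD _ _] := Fsub _ FX; apply: XD => //; exact: YX.
  - by move=> a x [X FX Xx]; exists X => //; have [_ XM _] := Fsub _ FX; exact: XM.
  - by move=> [X FX X1]; have [_ _] := Fsub _ FX.
(* [sub] admits the empty set, which is the union of the empty chain, so 0 enters only by
   maximality. *)
have W0 : W 0.
  apply: contrapT => NW0; apply: (Wmax (W `|` [set 0])).
    by split=> [x|/(_ 0)]; [left|move=> H; apply: NW0; apply: H; right].
  split.
  - move=> x y [Wx|->] [Wy|->]; rewrite ?addr0 ?add0r; try by [left|right].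
    by left; exact: WD.
  - by move=> a x [Wx|->]; [left; exact: WM|right; rewrite mulr0].
  - by move=> [//|/eqP]; rewrite oner_eq0.
have WN x : W x -> W (- x).
  move=> Wx; have -> : - x = (-1) ^+ p * x by rewrite pN expr1n mulN1r.
  exact: WM.
(* Otherwise W + K^p x would be a larger subspace still avoiding 1: a relation 1 = w + b^p x makes x
   congruent to b^(-p) modulo W. *)
have ex x : exists a, W (x - a ^+ p).
  have [Wx|NWx] := pselect (W x).
    by exists 0; rewrite expr0n gtn_eqF // subr0.
  apply: contrapT => Nex; apply: (Wmax [set w + b ^+ p * x | w in W & b in setT]).
    split=> [w Ww|/(_ x)].
      by exists w => //; exists 0 => //; rewrite expr0n gtn_eqF // mul0r addr0.
    by move=> H; apply: NWx; apply: H; exists 0 => //; exists 1; rewrite // expr1n mul1r add0r.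
  split.
  - move=> _ _ [w Ww [b _ <-]] [w' Ww' [b' _ <-]]; exists (w + w'); first exact: WD.
    by exists (b + b') => //; rewrite pD mulrDl addrACA.
  - move=> a _ [w Ww [b _ <-]]; exists (a ^+ p * w); first exact: WM.
    by exists (a * b) => //; rewrite mulrDr exprMn mulrA.
  - move=> [w Ww [b _ E]]; apply: Nex.
    have [b0|b0] := eqVneq b 0.
      by case: W1; rewrite -E b0 expr0n gtn_eqF // mul0r addr0.
    exists b^-1; have -> : x - b^-1 ^+ p = b^-1 ^+ p * (- w); last by apply: WM; exact: WN.
    rewrite -[X in _ = _ * X](addrK (b ^+ p * x)) addrAC [in X in _ = _ * X]addrC.
    have -> : b ^+ p * x + (- w - b ^+ p * x) = - w by rewrite addrCA subrr addr0.
    have <- : b ^+ p * x - 1 = - w by rewrite -E opprD addrCA subrr addr0.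
    by rewrite mulrBr mulr1 mulrA -exprMn mulVf // expr1n mul1r.
have uniq x a b : W (x - a ^+ p) -> W (x - b ^+ p) -> a = b.
  move=> Wa Wb; apply/eqP; rewrite -subr_eq0; apply/negPn/negP => ab; apply: W1.
  have : W (x - b ^+ p + - (x - a ^+ p)) by apply: WD => //; exact: WN.
  have -> : x - b ^+ p + - (x - a ^+ p) = (a - b) ^+ p by rewrite pD pN; ring.
  move=> /(WM (a - b)^-1); by rewrite -exprMn mulVf // expr1n.
have [psi Hpsi] := choice ex; exists psi; split; first split.
- move=> x y; apply: (uniq (x + y)) => //.
  have -> : x + y - (psi x + psi y) ^+ p = (x - psi x ^+ p) + (y - psi y ^+ p).
    by rewrite pD opprD addrACA.
  exact: WD.
- move=> a x; apply: (uniq (a ^+ p * x)) => //.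
  by rewrite exprMn -mulrBr; exact: WM.
- by apply: (uniq 1) => //; rewrite expr1n subrr.
Qed.

Lemma frobenius_splitting_iter e :
  exists psi : K -> K, root_linear (p ^ e) psi /\ psi 1 = 1.
Proof.
have [psi [psiL psi1]] := frobenius_splitting.
elim: e => [|e [phi [phiL phi1]]].
  by exists id; split=> //; split=> // a x; rewrite expr1.
exists (fun x => psi (phi x)); split; last by rewrite phi1.
by rewrite expnSr; exact: root_linear_comp.
Qed.

Lemma root_functional e (y : K) : y != 0 ->
  exists phi : K -> K, root_linear (p ^ e) phi /\ phi y = 1.
Proof.
move=> y0; have [psi [psiL psi1]] := frobenius_splitting_iter e.
exists (fun x => psi (y^-1 * x)); split; first exact: root_linear_mul.
by rewrite mulVf.
Qed.

(* The new dual pair is [(psi \o pi, pi y)] where [pi] is the defect of the old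
   pairs, which vanishes on [s], and [psi] sends [pi y] to 1. *)
Lemma root_duals_seq e (s : seq K) : exists (T : finType) (phi : T -> K -> K) (c : T -> K),
  (forall j, root_linear (p ^ e) (phi j)) /\
  {in s, forall x, x = \sum_j phi j x ^+ (p ^ e) * c j}.
Proof.
elim: s => [|y s [T [phi [c [phiL Hs]]]]].
  by exists void, (fun _ => id), (fun=> 0); split=> [[]|//].
pose pi x := x - \sum_j phi j x ^+ (p ^ e) * c j.
have piL psi : root_linear (p ^ e) psi -> root_linear (p ^ e) (fun x => psi (pi x)).
  move=> [psiD psiM]; split=> [a b|a b].
    rewrite -psiD /pi; congr psi; rewrite addrACA -opprD -big_split /=.
    by congr (_ - _); apply: eq_bigr => j _; rewrite (phiL j).1 exprDp mulrDl.
  rewrite -psiM /pi; congr psi; rewrite mulrBr big_distrr /=; congr (_ - _).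
  by apply: eq_bigr => j _; rewrite (phiL j).2 exprMn mulrA.
have [y0|y0] := eqVneq (pi y) 0.
  exists T, phi, c; split=> // x; rewrite inE => /orP[/eqP->|/Hs//].
  by apply/eqP; rewrite -subr_eq0; exact/eqP.
have [psi [psiL psiy]] := root_functional e y0.
exists (option T : finType), (fun j => if j is Some t then phi t else fun x => psi (pi x)),
  (fun j => if j is Some t then c t else pi y); split=> [[t|] //|x xs].
  exact: piL.
rewrite sum_option /=.
move: xs; rewrite inE => /orP[/eqP->|xs]; first by rewrite psiy expr1n mul1r subrK.
have -> : pi x = 0 by rewrite /pi -Hs // subrr.
rewrite (root_linear0 psiL) expr0n gtn_eqF ?mul0r ?add0r -?Hs //.
by rewrite expn_gt0 prime_gt0 // (pcharf_prime charK).
Qed.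

End FrobeniusSplitting.

(** * Frobenius roots of polynomials *)

Section MpolyRoots.
Variables (K : fieldType) (n p : nat).
Hypothesis charK : p \in [pchar K].
Implicit Types (x y f g : {mpoly K[n]}) (m u : 'X_{1..n}).

Definition mnm_div (q : nat) m : 'X_{1..n} := [multinom (m i %/ q)%N | i < n].
Definition mnm_mod (q : nat) m : 'X_{1..n} := [multinom (m i %% q)%N | i < n].

Lemma mnm_divn_eq q m : m = (mnm_div q m *+ q + mnm_mod q m)%MM.
Proof. by apply/mnmP => i; rewrite mnmDE mulmnE !mnmE -divn_eq. Qed.

Lemma mnm_modn_small q m : (forall i, m i < q)%N -> mnm_mod q m = m.
Proof. by move=> mq; apply/mnmP => i; rewrite mnmE modn_small. Qed.

Lemma pchar_mpoly : p \in [pchar {mpoly K[n]}].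
Proof.
have [pr /eqP p0] := andP charK; rewrite inE pr /=.
by rewrite -(rmorph_nat (@mpolyC n K)) p0 rmorph0.
Qed.

Lemma mpoly_exprDp e x y : (x + y) ^+ (p ^ e) = x ^+ (p ^ e) + y ^+ (p ^ e).
Proof.
rewrite exprDn_pchar // pnatX; apply/orP; left.
by rewrite pnatE ?pchar_mpoly // (pcharf_prime charK).
Qed.

Lemma mpoly_exprp_sum e (T : Type) (r : seq T) (Q : pred T) (F : T -> {mpoly K[n]}) :
  (\sum_(i <- r | Q i) F i) ^+ (p ^ e) = \sum_(i <- r | Q i) F i ^+ (p ^ e).
Proof.
apply: (big_morph (fun x => x ^+ (p ^ e))); first exact: mpoly_exprDp.
by rewrite expr0n gtn_eqF // expn_gt0 prime_gt0 // (pcharf_prime charK).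
Qed.

Lemma sum_msupp (V : nmodType) x (s : seq 'X_{1..n}) (F : 'X_{1..n} -> V) :
  uniq s -> {subset msupp x <= s} -> (forall m, x@_m = 0 -> F m = 0) ->
  \sum_(m <- msupp x) F m = \sum_(m <- s) F m.
Proof.
move=> us sub F0; rewrite [RHS](bigID (mem (msupp x))) /= [X in _ + X]big1 ?addr0.
  rewrite -[RHS]big_filter; apply: perm_big; apply: uniq_perm => //.
    exact: filter_uniq.
  by move=> m; rewrite mem_filter; apply/idP/andP => [mx|[]//]; split=> //; exact: sub.
by move=> m /memN_msupp_eq0 /F0.
Qed.

(* The component at ['X_[u]] of the [q]-th root of [x], read through the
   coefficient functional [phi]; meaningful when the entries of [u] are [< q]. *)
Definition mpoly_root (q : nat) (phi : K -> K) u x : {mpoly K[n]} :=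
  \sum_(m <- msupp x) (if mnm_mod q m == u then phi x@_m *: 'X_[mnm_div q m] else 0).

Variable e : nat.
Let q := (p ^ e)%N.

Lemma q_gt0 : (0 < q)%N.
Proof. by rewrite expn_gt0 prime_gt0 // (pcharf_prime charK). Qed.

Variables (phi : K -> K) (phiL : root_linear q phi).

Lemma mpoly_rootD u x y :
  mpoly_root q phi u (x + y) = mpoly_root q phi u x + mpoly_root q phi u y.
Proof.
pose s := undup (msupp x ++ msupp y ++ msupp (x + y)).
have phi0 c m : c = 0 -> (if mnm_mod q m == u then phi c *: 'X_[mnm_div q m] else 0)
    = 0 :> {mpoly K[n]}.
  by move=> ->; rewrite (root_linear0 phiL) scale0r if_same.
have E z : z \in [:: x; y; x + y] -> mpoly_root q phi u z =
    \sum_(m <- s) (if mnm_mod q m == u then phi z@_m *: 'X_[mnm_div q m] else 0).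
  move=> zs; apply: sum_msupp => [||m]; [exact: undup_uniq| |exact: phi0].
  move=> m mz; rewrite mem_undup !mem_cat; move: zs mz.
  by rewrite !inE => /or3P[] /eqP-> ->; rewrite ?orbT.
rewrite !E ?inE ?eqxx ?orbT // -big_split /=; apply: eq_bigr => m _.
by case: ifP; rewrite ?addr0 // mcoeffD phiL.1 scalerDl.
Qed.

Lemma mpoly_rootZX u c m : mpoly_root q phi u (c *: 'X_[m]) =
  if mnm_mod q m == u then phi c *: 'X_[mnm_div q m] else 0.
Proof.
have [->|c0] := eqVneq c 0.
  by rewrite /mpoly_root scale0r msupp0 big_nil (root_linear0 phiL) scale0r if_same.
by rewrite /mpoly_root msuppMCX // big_seq1 mcoeffZ mcoeffX eqxx mulr1.
Qed.

Lemma mpoly_root_sum u (T : Type) (r : seq T) (F : T -> {mpoly K[n]}) :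
  mpoly_root q phi u (\sum_(i <- r) F i) = \sum_(i <- r) mpoly_root q phi u (F i).
Proof.
apply: (big_morph (mpoly_root q phi u)); first exact: mpoly_rootD.
by rewrite /mpoly_root msupp0 big_nil.
Qed.

Lemma mnm_modMD m k : mnm_mod q (m *+ q + k) = mnm_mod q k.
Proof. by apply/mnmP => i; rewrite [LHS]mnmE [RHS]mnmE mnmDE mulmnE modnMDl. Qed.

Lemma mnm_divMD m k : mnm_div q (m *+ q + k) = (m + mnm_div q k)%MM.
Proof. by apply/mnmP => i; rewrite [LHS]mnmE mnmDE mnmDE [mnm_div q k i]mnmE mulmnE divnMDl ?q_gt0. Qed.

Lemma root_linear_mpoly_root u : root_linear q (mpoly_root q phi u).
Proof.
split=> [|a x]; first exact: mpoly_rootD.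
rewrite {1}(mpolyE x) {1}(mpolyE a) mpoly_exprp_sum big_distrl mpoly_root_sum /=.
rewrite [in RHS](mpolyE a) [RHS]big_distrl /=; apply: eq_bigr => m _.
rewrite big_distrr mpoly_root_sum /= [in RHS]/mpoly_root [RHS]big_distrr /=.
apply: eq_bigr => k _; rewrite exprZn mpolyXn -scalerAl -scalerAr scalerA -mpolyXD.
rewrite mpoly_rootZX mnm_modMD mnm_divMD; case: ifP => _; last by rewrite mulr0.
by rewrite phiL.2 mpolyXD -scalerA -scalerAl -scalerAr.
Qed.

End MpolyRoots.

Section MpolyRootDuals.
Variables (K : fieldType) (n p : nat).
Hypothesis charK : p \in [pchar K].
Implicit Types (x y f g : {mpoly K[n]}) (m u : 'X_{1..n}).

(** The pairs combine a residue monomial with a dual pair for the coefficients of [x]. Taking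
    residues does not raise degrees, so exponents of degree below [B] include all those that
    occur. *)
Lemma has_root_duals_mpoly e : has_root_duals {mpoly K[n]} (p ^ e).
Proof.
move=> x; have [T [phi [c [phiL Hs]]]] := root_duals_seq charK e [seq x@_m | m <- msupp x].
pose B := (msize x).+1.
exists ('X_{1..n < B} * T)%type, (fun t : 'X_{1..n < B} * T => mpoly_root (p ^ e) (phi t.2) (t.1 : 'X_{1..n})),
  (fun t : 'X_{1..n < B} * T => c t.2 *: 'X_[t.1]); split=> [[u j]|].
  exact: root_linear_mpoly_root.
rewrite -(pair_bigA _ (fun (u : 'X_{1..n < B}) j =>
  mpoly_root (p ^ e) (phi j) u x ^+ (p ^ e) * (c j *: 'X_[u]))) /=.
transitivity (\sum_(m <- msupp x) \sum_(u : 'X_{1..n < B}) \sum_j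
   (if mnm_mod (p ^ e) m == u :> 'X_{1..n}
    then (phi j x@_m ^+ (p ^ e) * c j) *: 'X_[m] else 0)); last first.
  rewrite exchange_big /=; apply: eq_bigr => u _; rewrite exchange_big /=.
  apply: eq_bigr => j _; rewrite mpoly_exprp_sum // big_distrl /=.
  apply: eq_bigr => m _; case: ifP => [/eqP E|_]; last first.
    rewrite expr0n gtn_eqF ?mul0r //.
    by rewrite expn_gt0 prime_gt0 // (pcharf_prime charK).
  rewrite exprZn mpolyXn -scalerAl -scalerAr scalerA -mpolyXD -E.
  by rewrite -mnm_divn_eq.
rewrite [LHS]mpolyE [LHS]big_seq [RHS]big_seq; apply: eq_bigr => m mx.
have sz : (mdeg (mnm_mod (p ^ e) m) < B)%N.
  rewrite ltnS; apply: leq_trans (ltnW (msize_mdeg_lt mx)).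
  by rewrite !mdegE; apply: leq_sum => i _; rewrite mnmE leq_mod.
rewrite (bigD1 (BMultinom sz)) //= [X in _ + X]big1 ?addr0.
  by rewrite eqxx -scaler_suml -Hs //; exact: map_f.
move=> u /eqP ne; apply: big1 => j _; case: eqP => // E.
by case: ne; exact/val_inj.
Qed.

(** Only one monomial of [x] has residue [u], so the component of the root at [u] is a constant,
    which the choice of [phi] makes 1. *)
Lemma root_linear_unit e x u : (forall i, u i < p ^ e)%N -> u \in msupp x ->
  {in msupp x, forall m, mnm_mod (p ^ e) m = u -> m = u} ->
  exists Phi, root_linear (p ^ e) Phi /\ Phi x = 1.
Proof.
move=> uq ux uniq; have [phi [phiL phi1]] : exists phi, root_linear (p ^ e) phi /\
    phi x@_u = 1 by apply: root_functional => //; rewrite -mcoeff_msupp.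
exists (mpoly_root (p ^ e) phi u); split; first exact: root_linear_mpoly_root.
rewrite /mpoly_root (bigD1_seq u) //= mnm_modn_small // eqxx phi1 scale1r.
rewrite big_seq_cond big1 ?addr0 => [|m /andP[mx mu]].
  have -> : mnm_div (p ^ e) u = 0%MM; last exact: mpolyX0.
  by apply/mnmP => i; rewrite mnmE mnm0E divn_small.
by case: eqP => // /(uniq _ mx) E; rewrite E eqxx in mu.
Qed.

(** Once q exceeds the degree, exponents are their own residues and any monomial of [x] will do. *)
Lemma root_linear_unit_large x e : x != 0 -> (msize x <= p ^ e)%N ->
  exists Phi, root_linear (p ^ e) Phi /\ Phi x = 1.
Proof.
move=> x0 xq; have small m : m \in msupp x -> forall i, (m i < p ^ e)%N.
  move=> /msize_mdeg_lt mx i; apply: leq_trans xq; apply: leq_trans mx.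
  by rewrite ltnS mdegE (bigD1 i) //= leq_addr.
have mx := mlead_supp x0.
apply: (root_linear_unit (small _ mx) mx) => m /small mq.
by rewrite mnm_modn_small.
Qed.

Lemma initial_monomialM le f g a b : term_order le ->
  is_initial_monomial le f a -> is_initial_monomial le g b ->
  is_initial_monomial le (f * g) (a + b)%MM.
Proof.
move=> [[le_refl le_anti] le_trans _ _ leD] [fa Hf] [gb Hg].
have leDl c d d' : le d d' -> le (c + d)%MM (c + d')%MM.
  by rewrite !(addmC c); exact: leD.
have bound m1 m2 : m1 \in msupp f -> m2 \in msupp g -> le (m1 + m2)%MM (a + b)%MM.
  move=> /Hf l1 /Hg l2; apply: le_trans (leDl a _ _ l2); exact: leD.
split; last first.
  move=> m /msuppM_le /allpairsP[[m1 m2] /= [m1f m2g ->]]; exact: bound.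
have -> : (a + b)%MM \in msupp (f * g) = ((f * g)@_(a + b) != 0) by rewrite mcoeff_msupp.
rewrite mpolyME big_allpairs raddf_sum /= (bigD1_seq a) //= raddf_sum /= (bigD1_seq b) //=.
rewrite mcoeffZ mcoeffX eqxx mulr1 [X in _ + X + _]big_seq_cond.
rewrite [X in _ + X + _]big1 => [|m2 /andP[m2g m2b]]; last first.
  rewrite mcoeffZ mcoeffX; case: eqP => [/addmI E|]; last by rewrite mulr0.
  by rewrite E eqxx in m2b.
rewrite [X in _ + _ + X]big_seq_cond [X in _ + _ + X]big1 => [|m1 /andP[m1f m1a]].
  by rewrite !addr0 mulf_neq0 // -mcoeff_msupp.
rewrite raddf_sum big_seq /= big1 // => m2 m2g.
rewrite mcoeffZ mcoeffX; case: eqP => [E|]; last by rewrite mulr0.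
(* An equality a + b = m1 + m2 with m2 <= b squeezes m1 + b to a + b, and cancellation gives m1 =
   a. *)
have l1 : le (m1 + b)%MM (a + b)%MM by apply: leD; exact: Hf.
have l2 : le (a + b)%MM (m1 + b)%MM by rewrite -E; apply: leDl; exact: Hg.
have /le_anti : le (m1 + b)%MM (a + b)%MM && le (a + b)%MM (m1 + b)%MM by rewrite l1.
rewrite !(addmC _ b) => /addmI E'.
by rewrite E' eqxx in m1a.
Qed.

Lemma initial_monomialX le f a k : term_order le ->
  is_initial_monomial le f a -> is_initial_monomial le (f ^+ k) (a *+ k)%MM.
Proof.
move=> leT fa; elim: k => [|k IH]; last by rewrite exprS mulmS; exact: initial_monomialM.
have [[le_refl _] _ _ _ _] := leT.
rewrite expr0 mulm0n; split; first by rewrite msupp1 inE.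
by move=> b; rewrite msupp1 inE => /eqP ->.
Qed.

(** As a is squarefree, (q - 1) a has entries below q. A monomial of f^(q-1) with this residue is (q
    - 1) a plus q times some exponent, hence not smaller; as (q - 1) a is the initial exponent, they
    coincide. *)
Lemma root_linear_unit_squarefree le f a e : term_order le ->
  is_initial_monomial le f a -> squarefree_monomial a ->
  exists Phi, root_linear (p ^ e) Phi /\ Phi (f ^+ (p ^ e).-1) = 1.
Proof.
move=> leT fa sqf; have [iu Hu] := initial_monomialX (p ^ e).-1 leT fa.
have q_gt0 : (0 < p ^ e)%N by rewrite expn_gt0 prime_gt0 // (pcharf_prime charK).
apply: root_linear_unit iu _ => [i|m mx E].
  rewrite mulmnE; apply: leq_ltn_trans (_ : 1 * (p ^ e).-1 < _)%N.
    by rewrite leq_mul2r sqf orbT.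
  by rewrite mul1n prednK.
have [[_ le_anti] _ _ le0 leD] := leT.
have l1 := Hu m mx; apply: le_anti; rewrite l1 /=.
rewrite [X in le _ X](mnm_divn_eq (p ^ e) m) E -[X in le X _]add0m.
by apply: leD; exact: le0.
Qed.

End MpolyRootDuals.

(** * Polynomial rings are regular *)

Section MpolyTower.
Variable K : fieldType.

Definition poly_to_mpoly n : {poly {mpoly K[n]}} -> {mpoly K[n.+1]} :=
  horner_eval 'X_ord_max \o map_poly (@mwiden n K).

HB.instance Definition _ n := GRing.RMorphism.on (@poly_to_mpoly n).

Lemma poly_to_mpolyC n c : @poly_to_mpoly n c%:P = mwiden c.
Proof. by rewrite /poly_to_mpoly /= map_polyC /horner_eval hornerC. Qed.

Lemma poly_to_mpolyX n : @poly_to_mpoly n 'X = 'X_ord_max.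
Proof. by rewrite /poly_to_mpoly /= map_polyX /horner_eval hornerX. Qed.

Lemma muniX n (m : 'X_{1..n.+1}) :
  muni ('X_[m] : {mpoly K[n.+1]}) =
  ('X_[[multinom m (widen_ord (leqnSn n) i) | i < n]])%:P * 'X^(m ord_max).
Proof. by rewrite muniE msuppX big_seq1 mcoeffX eqxx scale1r mul_polyC. Qed.

Lemma muni_mwiden n (c : {mpoly K[n]}) : muni (mwiden c) = c%:P.
Proof.
rewrite [c]mpolyE (raddf_sum (@mwiden n K)) (raddf_sum (@muni n K)) (raddf_sum polyC).
apply: eq_bigr => m _ /=.
rewrite mwidenZ muniZ mwidenX muniX mnmwiden_ordmax expr0 mulr1.
rewrite -mul_polyC -polyCM mul_mpolyC; congr (_ *: 'X_[_])%:P.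
by apply/mnmP => i; rewrite mnmE mnmwiden_widen.
Qed.

Lemma poly_to_mpolyK n : cancel (@poly_to_mpoly n) (@muni n K).
Proof.
elim/poly_ind => [|P c IH]; first by rewrite !rmorph0.
rewrite !rmorphD !rmorphM /= IH; congr (_ * _ + _).
  rewrite poly_to_mpolyX muniX.
  rewrite mnm1E eqxx expr1 [[multinom _ | _ < _]](_ : _ = 0%MM) ?mpolyX0 ?mul1r //.
  apply/mnmP => i; rewrite mnmE mnm1E mnm0E; case: eqP => // /(congr1 val) /= E.
  by have := ltn_ord i; rewrite -E ltnn.
by rewrite poly_to_mpolyC muni_mwiden.
Qed.

Lemma muniK n : cancel (@muni n K) (@poly_to_mpoly n).
Proof.
move=> x; rewrite [x]mpolyE (raddf_sum (@muni n K)) (raddf_sum (@poly_to_mpoly n)); apply: eq_bigr => m _ /=.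
rewrite muniZ muniX -mul_polyC !rmorphM rmorphXn /=.
rewrite !poly_to_mpolyC poly_to_mpolyX mwidenC mwidenX mpolyXn -mpolyXD mul_mpolyC; congr (_ *: 'X_[_]).
apply/mnmP => i; rewrite mnmDE mulmnE mnm1E.
have [j ->|->] := unliftP ord_max i; last first.
  by rewrite mnmwiden_ordmax eqxx mul1n.
have -> : lift ord_max j = widen_ord (leqnSn n) j.
  by apply: val_inj; rewrite /= /bump leqNgt ltn_ord.
rewrite mnmwiden_widen mnmE; case: eqP => [/(congr1 val) /= E|]; last by rewrite mul0n addn0.
by have := ltn_ord j; rewrite -E ltnn.
Qed.

Lemma regular_tower_mpoly n : regular_tower {mpoly K[n]}.
Proof.
elim: n => [|n IH].
  apply: (@regular_tower_iso K {mpoly K[0]} (@mpolyC 0 K) (mcoeff 0%MM)).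
  - exact: mpolyCK.
  - move=> x /=; apply/mpolyP => m; rewrite mcoeffC.
    have -> : m = 0%MM by apply/mnmP => -[].
    by rewrite eqxx mulr1.
  - exact: regular_tower_field.
by apply: (regular_tower_iso (@poly_to_mpolyK n) (@muniK n)); exact: regular_tower_poly.
Qed.

End MpolyTower.

(** * The associated graded ring is a domain *)

Section GradedDomain.
Variable A : idomainType.
Implicit Types (P Q q : set A) (s : seq A).

(* The localized ring [\bigoplus_d (s)^d / Q (s)^d] is a domain. *)
Definition graded_domain P Q s : Prop := forall d e x y,
  ideal_exp (gens s) d x -> ideal_exp (gens s) e y ->
  saturation P (ideal_mul Q (ideal_exp (gens s) (d + e))) (x * y) ->
  saturation P (ideal_mul Q (ideal_exp (gens s) d)) x \/
  saturation P (ideal_mul Q (ideal_exp (gens s) e)) y.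

Lemma saturation_prime P Q : is_prime_ideal Q -> Q `<=` P -> saturation P Q `<=` Q.
Proof. by move=> /is_prime_idealP[_ _ QM] QP x [s Ps /QM[/QP //|]]. Qed.

Lemma graded_domain_nil P Q : is_prime_ideal P -> is_prime_ideal Q -> Q `<=` P ->
  graded_domain P Q [::].
Proof.
move=> primeP primeQ QP; have /is_prime_idealP[idQ _ QM] := primeQ.
have idS d : is_ideal (saturation P (ideal_mul Q (ideal_exp (gens [::]) d))).
  exact: is_ideal_saturation.
case=> [|d] e x y; last first.
  by move=> /ideal_exp_gens_nil -> // _ _; left; exact: ideal_0.
case: e => [|e]; last first.
  by move=> _ /ideal_exp_gens_nil -> // _; right; exact: ideal_0.
move=> _ _; rewrite /= ideal_mulT // => /(saturation_prime primeQ QP).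
by case/QM => ?; [left|right]; exact: saturation_sub.
Qed.

(** The power of (s) is climbed one step at a time: if x is in (s)^b with b < d, then y x is in q
    (s)^b; y is nonzero in degree 0 of the graded domain, so x is in q (s)^b, which is (s)^(b+1)
    locally at P. *)
Lemma graded_domain_colon P q s d x y : is_prime_ideal P -> is_prime_ideal q ->
  q `<=` P -> gens s `<=` q -> q `<=` saturation P (gens s) -> graded_domain P q s ->
  ~ q y -> saturation P (ideal_exp (gens s) d) (y * x) ->
  saturation P (ideal_exp (gens s) d) x.
Proof.
move=> primeP primeq qP sq qs dom qy [s0 Ps0 Hyx].
have /is_prime_idealP[idq _ _] := primeq.
suff : forall b, (b <= d)%N -> saturation P (ideal_exp (gens s) b) x by apply.
elim=> [_|b IH bd]; first exact: saturation_sub.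
have [t Pt tx] := IH (ltnW bd).
have Hy : ideal_exp (gens s) 0 y by [].
have [|H|H] := dom 0%N b y (t * x) Hy tx.
- exists s0 => //; rewrite add0n.
  apply: (ideal_mul_mono sq (@subset_refl _ _)); rewrite -ideal_expS.
  apply: (ideal_exp_le bd); have -> : s0 * (y * (t * x)) = t * (s0 * (y * x)) by ring.
  by ideal_mullT.
- by case: qy; apply: (saturation_prime primeq qP); move: H; rewrite /= ideal_mulT.
apply: (saturation_mulK primeP Pt); apply: (saturationK primeP).
apply: saturation_mono H => z; rewrite ideal_expS.
apply: ideal_mul_min => [|a c qa sc]; first exact: is_ideal_saturation.
by apply: saturation_mul => //; [exact: qs|exact: saturation_sub].
Qed.

Section Step.
Variables (P Q : set A) (s : seq A) (y : A).
Hypotheses (primeP : is_prime_ideal P) (primeQ : is_prime_ideal Q).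
Hypotheses (sQ : gens s `<=` Q) (Qy : Q y).
Hypothesis colon : forall d x, saturation P (ideal_exp (gens s) d) (y * x) ->
  saturation P (ideal_exp (gens s) d) x.
Let QE d := ideal_mul Q (ideal_exp (gens s) d).

Let idQ : is_ideal Q. Proof. by have /is_prime_idealP[] := primeQ. Qed.
Let idSQ d : is_ideal (saturation P (QE d)).
Proof. by apply: is_ideal_saturation => //; exact: is_ideal_mul. Qed.
Let idSE d : is_ideal (saturation P (ideal_exp (gens s) d)).
Proof. exact: is_ideal_saturation. Qed.

(** This makes the class of y a free variable over the graded ring of (s) modulo Q. The constant
    term is g_0 = - y t; [colon] puts t in (s)^N, hence g_0 in Q (s)^N, and cancelling y shortens
    the relation. *)
Lemma graded_relation M N (g : nat -> A) : (M <= N.+1)%N ->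
  (forall k, (k < M)%N -> saturation P (ideal_exp (gens s) (N - k)) (g k)) ->
  \sum_(k < M) g k * y ^+ k = 0 ->
  forall k, (k < M)%N -> saturation P (QE (N - k)) (g k).
Proof.
elim: M N g => // M IH N g MN Hg.
rewrite big_ord_recl /= expr0 mulr1; set t := \sum_(i < M) g i.+1 * y ^+ i.
have -> : \sum_(i < M) g (bump 0 i) * y ^+ bump 0 i = y * t.
  by rewrite big_distrr /=; apply: eq_bigr => i _; rewrite /bump add1n exprS; ring.
move=> /(canRL (addrK _)); rewrite sub0r => E0.
have Et : saturation P (ideal_exp (gens s) N) t.
  apply: colon; rewrite -[y * t]opprK -E0.
  by apply: ideal_opp => //; rewrite -[X in ideal_exp _ X](subn0 N); exact: Hg.
case=> [|k] kM.
  rewrite subn0 E0 -mulNr; apply: saturation_mul => //.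
  by apply: saturation_sub => //; exact: ideal_opp.
case: N MN Hg Et {E0} => [|N] MN Hg Et; first by move: MN kM; case: (M).
(* The identity defining [t] is read as a relation by moving [t] into the constant coefficient.
   Since [t] has order [N.+1] along (s) and (s) lies in Q, it can be added back at the end. *)
pose g' k := g k.+1 - (if k == 0%N then t else 0).
have Hg' k' : (k' < M)%N -> saturation P (ideal_exp (gens s) (N - k')) (g' k').
  move=> k'M; rewrite /g'; ideal_subT => //; first exact: (Hg k'.+1).
  case: eqP => [->|_]; last exact: ideal_0.
  by rewrite subn0; apply: saturation_mono Et; apply: ideal_exp_le; exact: leqnSn.
have sum' : \sum_(i < M) g' i * y ^+ i = 0.
  rewrite /g'; case: (M) kM @t {Et Hg' IH Hg MN g'} => // M' _ t.
  rewrite big_ord_recl /= expr0 mulr1 /t [in X in _ - X]big_ord_recl /= expr0 mulr1.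
  rewrite opprD addrA subrr add0r; apply/eqP; rewrite addrC subr_eq0; apply/eqP.
  by apply: eq_bigr => i _; rewrite subr0.
have := IH N g' MN Hg' sum' k kM; rewrite subSS.
case: k kM => [|k] kM; rewrite /g' /= ?subr0 // => H.
rewrite -(subrK t (g 1%N)); ideal_addT => //.
by rewrite /QE subn0; apply: saturation_mono Et; exact: (ideal_mul_mono sQ).
Qed.

Lemma ideal_mul_exp_gens_cons N x :
  saturation P (ideal_mul Q (ideal_exp (gens (y :: s)) N)) x ->
  exists2 t, ~ P t & exists2 h : nat -> A,
  forall k, (k <= N)%N -> QE (N - k) (h k) & t * x = \sum_(k < N.+1) h k * y ^+ k.
Proof.
move=> [t Pt Htx]; exists t => //; move: (t * x) Htx.
apply: (@ideal_mul_min _ _ _ [set x | exists2 h : nat -> A,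
  forall k, (k <= N)%N -> QE (N - k) (h k) & x = \sum_(k < N.+1) h k * y ^+ k]).
  split=> /=.
  - exists (fun=> 0) => [k _|]; first exact: (ideal_0 (is_ideal_mul _ _)).
    by rewrite big1 // => i _; rewrite mul0r.
  - move=> _ _ [F HF ->] [G HG ->]; exists (fun i => F i + G i).
      by move=> i iM; apply: (ideal_add (is_ideal_mul _ _)); [exact: HF|exact: HG].
    by rewrite -big_split; apply: eq_bigr => i _; rewrite /= mulrDl.
  - move=> a _ [F HF ->]; exists (fun i => a * F i).
      by move=> i iM; apply: (ideal_mull _ (is_ideal_mul _ _)); exact: HF.
    by rewrite big_distrr; apply: eq_bigr => i _; rewrite /= mulrA.
move=> a b Qa /ideal_exp_gens_cons[F HF ->]; exists (fun k => a * F k).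
  by move=> k kN; apply: ideal_mul_mem => //; exact: HF.
by rewrite big_distrr; apply: eq_bigr => i _; rewrite /= mulrA.
Qed.

Lemma graded_coef N (g : nat -> A) :
  (forall k, (k <= N)%N -> ideal_exp (gens s) (N - k) (g k)) ->
  saturation P (ideal_mul Q (ideal_exp (gens (y :: s)) N))
    (\sum_(k < N.+1) g k * y ^+ k) ->
  forall k, (k <= N)%N -> saturation P (QE (N - k)) (g k).
Proof.
move=> Hg /ideal_mul_exp_gens_cons[t Pt [h Hh E]] k kN.
apply: (saturation_mulK primeP Pt); rewrite -(subrK (h k) (t * g k)).
ideal_addT => //; last by apply: saturation_sub => //; exact: Hh.
apply: (@graded_relation N.+1 N (fun k => t * g k - h k)) => // [j jN|].
  apply: saturation_sub => //; ideal_subT => //; first by ideal_mullT => //; exact: Hg.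
  have := Hh j jN; apply: ideal_mul_min => // a b _ sb; by ideal_mullT.
rewrite (eq_bigr (fun i : 'I_N.+1 => t * (g i * y ^+ i) - h i * y ^+ i)).
  by rewrite big_split /= sumrN -big_distrr /= E subrr.
by move=> i _; rewrite mulrBl mulrA.
Qed.

(** Gauss's argument over the graded ring of (s): elements are polynomials in [y], whose
    coefficients [graded_coef] determines modulo Q. *)
Lemma graded_domain_cons : graded_domain P Q s -> graded_domain P Q (y :: s).
Proof.
move=> dom d e x z /ideal_exp_gens_cons[F HF ->] /ideal_exp_gens_cons[G HG ->] Hxz.
pose X := \poly_(i < d.+1) F i; pose Z := \poly_(i < e.+1) G i.
have HX i : ideal_exp (gens s) (d - i) X`_i /\ ((d < i)%N -> X`_i = 0).
  rewrite coef_poly ltnS; case: leqP => // id; last by split=> //; exact: ideal_0.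
  by split=> //; exact: HF.
have HZ i : ideal_exp (gens s) (e - i) Z`_i /\ ((e < i)%N -> Z`_i = 0).
  rewrite coef_poly ltnS; case: leqP => // ie; last by split=> //; exact: ideal_0.
  by split=> //; exact: HG.
have sub1 f D : (forall i, (i <= D)%N -> saturation P (QE (D - i)) (f i)) ->
    saturation P (ideal_mul Q (ideal_exp (gens (y :: s)) D)) (\sum_(i < D.+1) f i * y ^+ i).
  move=> Hf; apply: ideal_bigsum => [|i _]; first exact: is_ideal_saturation.
  have iD : (i <= D)%N by rewrite -ltnS.
  have [t Pt Ht] := Hf i iD; exists t => //; rewrite mulrA.
  have -> : ideal_exp (gens (y :: s)) D =
      ideal_mul (ideal_exp (gens (y :: s)) (D - i)) (ideal_exp (gens (y :: s)) i).
    by rewrite -ideal_expD subnK.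
  rewrite ideal_mulA; apply: ideal_mul_mem; last first.
    by apply: ideal_exp_X; apply: gens_mem; rewrite inE eqxx.
  move: Ht; apply: ideal_mul_mono => //; apply: ideal_exp_mono; apply: gens_sub.
  by move=> w ws; rewrite inE ws orbT.
have minimal (f : nat -> A) D : ~ saturation P (ideal_mul Q (ideal_exp (gens (y :: s)) D))
      (\sum_(i < D.+1) f i * y ^+ i) ->
    exists i, [/\ (i <= D)%N, ~ saturation P (QE (D - i)) (f i) &
      forall j, (j < i)%N -> saturation P (QE (D - j)) (f j)].
  move=> /(contra_not (sub1 f D))/existsNP[i0 /not_implyP[i0D Hi0]].
  have ex : exists i, `[< (i <= D)%N /\ ~ saturation P (QE (D - i)) (f i) >].
    by exists i0; apply/asboolP.
  case: (ex_minnP ex) => i /asboolP[iD Hi] Hm; exists i; split=> // j ji.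
  apply: contrapT => Hj; have := ji; rewrite ltnNge Hm //; apply/asboolP.
  by split=> //; exact: leq_trans (ltnW ji) iD.
(* [i0] and [j0] index the first coefficients that are nonzero in the graded ring; the coefficient
   of the product at [i0 + j0] will contradict [dom]. *)
apply: contrapT => /not_orP[/minimal[i0 [i0d Ni0 Hi0]] /minimal[j0 [j0e Nj0 Hj0]]].
have Exz : (\sum_(i < d.+1) F i * y ^+ i) * (\sum_(i < e.+1) G i * y ^+ i) =
    \sum_(k < (d + e).+1) (X * Z)`_k * y ^+ k.
  rewrite -(horner_poly _ F) -(horner_poly _ G) -hornerM; apply: horner_coef_wide.
  apply: leq_trans (size_polyMleq _ _) _.
  apply: (@leq_trans (d.+1 + e.+1).-1); last by rewrite addSn addnS.
  by rewrite -!subn1 leq_sub2r // leq_add // size_poly.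
have HXZ k : (k <= d + e)%N -> ideal_exp (gens s) (d + e - k) (X * Z)`_k.
  move=> kde; rewrite coefM; apply: ideal_bigsum => // i _.
  have [HXi HXi0] := HX i; have [HZi HZi0] := HZ (k - i)%N.
  have [/HXi0->|id] := ltnP d i; first by rewrite mul0r; exact: ideal_0.
  have [/HZi0->|ie] := ltnP e (k - i); first by rewrite mulr0; exact: ideal_0.
  have -> : (d + e - k = (d - i) + (e - (k - i)))%N.
    by move: (ltn_ord i) id ie kde; lia.
  exact: ideal_exp_mulmem.
rewrite Exz in Hxz; have k0 : (i0 + j0 <= d + e)%N by exact: leq_add.
have := graded_coef HXZ Hxz k0; rewrite coefM.
have i0k : (i0 < (i0 + j0).+1)%N by rewrite ltnS leq_addr.
rewrite (bigD1 (Ordinal i0k)) //= addKn => H.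
have Ede : (d + e - (i0 + j0) = (d - i0) + (e - j0))%N by move: i0d j0e; lia.
have X0 : X`_i0 = F i0 by rewrite coef_poly ltnS i0d.
have Z0 : Z`_j0 = G j0 by rewrite coef_poly ltnS j0e.
have : saturation P (QE (d - i0 + (e - j0))) (F i0 * G j0).
  rewrite -Ede -X0 -Z0 -[_ * _](addrK
    (\sum_(i < (i0 + j0).+1 | i != Ordinal i0k) X`_i * Z`_(i0 + j0 - i))).
  ideal_subT => //; apply: ideal_bigsum => // i /eqP ne.
  have [HXi HXi0] := HX i; have [HZi HZi0] := HZ (i0 + j0 - i)%N.
  have [/HXi0->|id] := ltnP d i; first by rewrite mul0r; exact: ideal_0.
  have [/HZi0->|ie] := ltnP e (i0 + j0 - i); first by rewrite mulr0; exact: ideal_0.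
  have E' : (d + e - (i0 + j0) = (d - i) + (e - (i0 + j0 - i)))%N.
    by move: (ltn_ord i) id ie k0; lia.
  have [lt|gt|eq] := ltngtP i i0.
  - rewrite E' /QE ideal_expD ideal_mulA; apply: saturation_mul => //.
      by rewrite coef_poly ltnS id; exact: Hi0.
    exact: saturation_sub.
  - rewrite E' addnC /QE ideal_expD ideal_mulA mulrC; apply: saturation_mul => //.
      rewrite coef_poly ltnS ie; apply: Hj0; move: (ltn_ord i) gt; lia.
    exact: saturation_sub.
  - by case: ne; exact: val_inj.
by case/(dom _ _ _ _ (HF _ i0d) (HG _ j0e)).
Qed.

End Step.
End GradedDomain.

(** * Symbolic powers in a regular ring *)

Lemma nat_maxP (X : set nat) B : (exists x, X x) -> (forall x, X x -> (x <= B)%N) ->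
  X (nat_max X) /\ forall j, X j -> (j <= nat_max X)%N.
Proof.
move=> [x Xx] XB; suff [l Hl] : exists l, X l /\ forall j, X j -> (j <= l)%N.
  exact: (@xgetI _ 0%N [set l | X l /\ forall j, X j -> (j <= l)%N] l Hl).
have ex : exists i, `[< X i >] by exists x; exact/asboolP.
have bnd i : `[< X i >] -> (i <= B)%N by move=> /asboolP; exact: XB.
case: (ex_maxnP ex bnd) => l /asboolP Xl Hm; exists l; split=> // j Xj.
by apply: Hm; exact/asboolP.
Qed.

Section RegularRing.
Variable A : idomainType.
Hypothesis towerA : regular_tower A.
Implicit Types (P q : set A) (Q : nat -> set A) (s : seq A).

Lemma prime_chain_le P h Q i j : prime_chain P h Q -> (i <= j <= h)%N -> Q i `<=` Q j.
Proof.
move=> [_ Qs _] /andP[ij jh]; elim: j ij jh => [|j IH]; first by rewrite leqn0 => /eqP-> _; exact: subset_refl.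
rewrite leq_eqVlt => /orP[/eqP->|ij] jh; first exact: subset_refl.
by apply: subset_trans (IH ij (ltnW jh)) _; exact: (Qs j jh).1.
Qed.

Lemma regular_chain_gens P h Q a i : regular_chain P h Q a -> (i <= h)%N ->
  gens (prefix_gens a i) `<=` Q i.
Proof.
move=> [ch Qa _] ih; have [Qp _ _] := ch.
have /is_prime_idealP[idQ _ _] := Qp _ ih.
apply: gens_min => // x; elim: i ih {idQ} x => // i IH ih x.
rewrite inE => /orP[/eqP->|/(IH (ltnW ih))]; first exact: Qa.
by apply: (prime_chain_le ch); rewrite leqnSn ih.
Qed.

(** Adjoining a_i uses two instances at i: the one for Q_i makes a_i a nonzerodivisor modulo powers
    of the previous generators, the other is for q itself. Hence the quantification over all q
    between Q_i and P. *)
Lemma regular_chain_graded_domain P h Q a i : is_prime_ideal P -> regular_chain P h Q a ->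
  (i <= h)%N -> forall q, is_prime_ideal q -> Q i `<=` q -> q `<=` P ->
  graded_domain P q (prefix_gens a i).
Proof.
move=> primeP reg; have [ch Qa Qsat] := reg; have [Qp Qs Qh] := ch.
have QP j : (j <= h)%N -> Q j `<=` P.
  by move=> jh; rewrite -Qh; apply: (prime_chain_le ch); rewrite jh leqnn.
elim: i => [|i IH] ih q primeq Qq qP; first exact: graded_domain_nil.
have Qi := QP _ (ltnW ih).
have sQi := regular_chain_gens reg (ltnW ih).
have Qii : Q i `<=` Q i.+1 by exact: (Qs i ih).1.
apply: graded_domain_cons => //.
- by apply: subset_trans sQi _; exact: subset_trans Qii Qq.
- by apply: Qq; exact: Qa.
- move=> d x; apply: (graded_domain_colon primeP (Qp _ (ltnW ih))) => //.
  + exact: Qsat (ltnW ih).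
  + by apply: IH => //; [exact: ltnW|exact: Qp (ltnW ih)].
  (* Were a_i in Q_i, the generators of Q_(i+1) at P would all lie in Q_i, against strictness of the
     chain. *)
  + move=> Qai; apply: (Qs i ih).2; apply: subset_trans (Qsat _ ih) _.
    have primeQ := Qp _ (ltnW ih); have /is_prime_idealP[idQ _ _] := primeQ.
    apply: subset_trans (saturation_prime primeQ Qi); apply: saturation_mono.
    apply: gens_min => // y; rewrite inE => /orP[/eqP-> //|ys].
    by apply: sQi; exact: gens_mem.
- by apply: IH => //; [exact: ltnW|exact: subset_trans Qii Qq].
Qed.

(** The generators come with a chain of primes ending at [P] whose length is their number; this
    bounds the number by the height. *)
Lemma prime_regular_gens P : is_prime_ideal P -> exists s : seq A,
  [/\ gens s `<=` P, P `<=` saturation P (gens s), graded_domain P P s &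
      (size s <= height P)%N].
Proof.
have [_ [B bnd] reg] := towerA; move=> primeP.
have [h [Q [a ra]]] := reg P primeP; exists (prefix_gens a h).
have [ch _ Qsat] := ra; have [_ _ Qh] := ch; split.
- by have := regular_chain_gens ra (leqnn h); rewrite Qh.
- by have := Qsat h (leqnn h); rewrite Qh.
- by apply: (regular_chain_graded_domain primeP ra (leqnn h)); rewrite ?Qh.
rewrite size_prefix_gens; apply: (@nat_maxP _ B _ _).2; last by exists Q.
  by exists h, Q.
by move=> x [Q' ch']; exact: bnd ch'.
Qed.

Lemma symbolic_power_gens P s d : is_prime_ideal P -> gens s `<=` P ->
  P `<=` saturation P (gens s) ->
  symbolic_power P d%:Z = saturation P (ideal_exp (gens s) d).
Proof.
move=> primeP sP Ps; rewrite symbolic_powerE //; apply/seteqP; split.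
  apply: subset_trans (saturationK primeP); apply: saturation_mono.
  exact: saturation_exp.
by apply: saturation_mono; exact: ideal_exp_mono.
Qed.

(* The order of vanishing along [P] is a valuation. *)
Lemma symbolic_power_prime P d e x y : is_prime_ideal P ->
  symbolic_power P d%:Z x -> symbolic_power P e%:Z y ->
  symbolic_power P (d + e).+1%:Z (x * y) ->
  symbolic_power P d.+1%:Z x \/ symbolic_power P e.+1%:Z y.
Proof.
move=> primeP; have [s [sP Ps dom _]] := prime_regular_gens primeP.
rewrite !(symbolic_power_gens _ primeP sP Ps) => -[t Pt tx] [u Pu uy] H.
have H' : saturation P (ideal_mul P (ideal_exp (gens s) (d + e))) ((t * x) * (u * y)).
  rewrite mulrACA; ideal_mullT; first exact: is_ideal_saturation.
  by apply: saturation_mono H; exact: ideal_mul_mono.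
have sub k : saturation P (ideal_mul P (ideal_exp (gens s) k)) `<=`
    saturation P (ideal_exp (gens s) k.+1).
  apply: subset_trans (saturationK primeP); apply: saturation_mono.
  apply: ideal_mul_min => [|a c Pa sc]; first exact: is_ideal_saturation.
  by apply: saturation_mul => //; [exact: Ps|exact: saturation_sub].
by have [/sub/(saturation_mulK primeP Pt)|/sub/(saturation_mulK primeP Pu)] :=
  dom d e _ _ tx uy H'; [left|right].
Qed.

Lemma symbolic_powerM P d e x y : is_prime_ideal P ->
  symbolic_power P d%:Z x -> symbolic_power P e%:Z y ->
  symbolic_power P (d + e)%N%:Z (x * y).
Proof.
by move=> primeP; rewrite !symbolic_powerE // ideal_expD; exact: saturation_mul.
Qed.

Lemma symbolic_power_le P d e : is_prime_ideal P -> (d <= e)%N ->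
  symbolic_power P e%:Z `<=` symbolic_power P d%:Z.
Proof.
by move=> primeP de; rewrite !symbolic_powerE //; apply: saturation_mono; exact: ideal_exp_le.
Qed.

Lemma symbolic_powerX P d x k : is_prime_ideal P ->
  symbolic_power P d%:Z x -> symbolic_power P (d * k)%N%:Z (x ^+ k).
Proof.
move=> primeP Px; elim: k => [|k IH]; last by rewrite exprS mulnS; exact: symbolic_powerM.
by rewrite muln0 symbolic_powerE //; exact: saturation_sub.
Qed.

Lemma ideal_exp_symbolic P d : is_prime_ideal P ->
  ideal_exp P d `<=` symbolic_power P d%:Z.
Proof. by move=> primeP; rewrite symbolic_powerE //; exact: saturation_sub. Qed.

Lemma symbolic_power_frobenius P p e l E : is_prime_ideal P -> P <> [set 0] ->
  (0 < p)%N -> has_root_duals A (p ^ e) ->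
  (p ^ e * (l + height P) <= E + p ^ e)%N ->
  symbolic_power P E%:Z `<=` frobenius_power p (symbolic_power P l%:Z) e.
Proof.
move=> primeP P0 p_gt0 duals HE x.
have /is_prime_idealP[idP _ _] := primeP.
have [s [sP Ps _ hs]] := prime_regular_gens primeP.
have idS := @is_ideal_symbolic_power A P l%:Z primeP.
(* At least one generator is needed for the strict inequality in the pigeonhole count; without any,
   [P] would be zero. *)
have s_gt0 : (0 < size s)%N.
  case: s sP Ps {hs} => // _ Ps; case: P0; apply/seteqP; split=> [y|_ ->]; last first.
    exact: ideal_0.
  move=> /Ps[t Pt /gens_nil/eqP]; rewrite mulf_eq0 => /orP[/eqP t0|/eqP //].
  by case: Pt; rewrite t0; exact: ideal_0.
rewrite (symbolic_power_gens _ primeP sP Ps) => -[t Pt].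
move=> /(@ideal_exp_sub_frobenius_power _ p s l E e p_gt0) tx.
have q_gt0 : (0 < p ^ e)%N by rewrite expn_gt0 p_gt0.
have {}tx : frobenius_power p (symbolic_power P l%:Z) e (t * x).
  apply: frobenius_power_mono (tx _).
    apply: subset_trans (ideal_exp_mono sP) _; exact: ideal_exp_symbolic.
  apply: leq_trans HE; rewrite mulnDr -addnS leq_add2l.
  apply: (@leq_trans (size s * p ^ e)); last by rewrite mulnC leq_mul2l hs orbT.
  by rewrite ltn_mul2l s_gt0 prednK /=.
(* Only t x is known to lie in the Frobenius power. Each functional turns t^q x into t phi x, and t
   is cancelled by saturation. *)
apply/(frobenius_powerP _ duals idS) => phi phiL.
have phi_tx : symbolic_power P l%:Z (phi (t ^+ (p ^ e) * x)).
  apply: root_linear_frobenius_power phiL _ => //.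
  by rewrite -(prednK q_gt0) exprSr -mulrA; ideal_mullT.
move: phi_tx; rewrite phiL.2 !symbolic_powerE //.
exact: saturation_mulK.
Qed.

End RegularRing.

(** * Integral closure and the exponents *)

Section IntegralClosure.
Variable A : idomainType.
Implicit Types (I J : set A).

Lemma integral_closure_mono I J : I `<=` J -> integral_closure I `<=` integral_closure J.
Proof.
move=> IJ f [d [a [d0 Ha E]]]; exists d, a; split=> // i /Ha.
exact: ideal_exp_mono.
Qed.

(* With [d] the degree of an integral equation of [h], the [A]-module spanned by
   the [J ^ (d - 1 - i) * h ^ i] is multiplied by [h] into its product with [J]. *)
Lemma integral_closure_almost J h z : is_ideal J -> J z -> z != 0 ->
  integral_closure J h -> exists2 c, c != 0 & forall k, ideal_exp J k (c * h ^+ k).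
Proof.
move=> idJ Jz z0 [d [a [d_gt0 Ha E]]]; exists (z ^+ d.-1); first exact: expf_neq0.
suff H k : exists b : nat -> A,
    (forall i, (i < d)%N -> ideal_exp J (d.-1 - i + k) (b i)) /\
    z ^+ d.-1 * h ^+ k = \sum_(i < d) b i * h ^+ i.
  move=> k; have [b [Hb ->]] := H k; apply: ideal_bigsum => // i _.
  ideal_mulrT => //; apply: (ideal_exp_le (leq_addl _ _)); exact: Hb.
elim: k => [|k [b [Hb Eb]]].
  exists (fun i => if i == 0%N then z ^+ d.-1 else 0); split=> [i id|].
    rewrite addn0; case: eqP => [->|_]; last exact: ideal_0.
    by rewrite subn0; exact: ideal_exp_X.
  case: (d) d_gt0 => // d' _; rewrite big_ord_recl /= expr0 big1 ?addr0 // => i _.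
  by rewrite mul0r.
(* Multiplication by [h] shifts the coefficients; the overflow in h^d is rewritten by the integral
   equation, which gives the second term. *)
exists (fun j => (if (0 < j)%N then b j.-1 else 0) - b d.-1 * a (d - j)%N); split.
  move=> j jd; ideal_subT => //.
    case: j jd => [|j] jd /=; first exact: ideal_0.
    have -> : (d.-1 - j.+1 + k.+1 = d.-1 - j + k)%N by move: jd d_gt0; lia.
    by apply: Hb; exact: ltnW.
  have -> : (d.-1 - j + k.+1 = (d.-1 - d.-1 + k) + (d - j))%N by move: jd d_gt0; lia.
  apply: ideal_exp_mulmem; first by apply: Hb; rewrite prednK.
  by apply: Ha; move: jd; lia.
have Eh : h ^+ d = - \sum_(j < d) a (d - j)%N * h ^+ j.
  move/eqP: E; rewrite addr_eq0 => /eqP ->; congr (- _).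
  rewrite big_add1 /= big_mkord (reindex_inj rev_ord_inj) /=.
  apply: eq_bigr => i _; have id := ltn_ord i.
  by rewrite subnSK // subKn // ltnW.
rewrite exprSr mulrA Eb big_distrl /=.
rewrite [RHS](eq_bigr (fun j : 'I_d => (if (0 < j)%N then b j.-1 else 0) * h ^+ j -
   b d.-1 * (a (d - j)%N * h ^+ j))); last by move=> j _; rewrite mulrBl mulrA.
rewrite big_split /= sumrN -big_distrr /= -mulrN -Eh.
case: (d) d_gt0 => // d' _; rewrite big_ord_recr [in RHS]big_ord_recl /=.
rewrite mul0r add0r -mulrA -exprSr; congr (_ + _); apply: eq_bigr => i _.
by rewrite -mulrA -exprSr.
Qed.

End IntegralClosure.

(** * Briancon-Skoda and finiteness of the order along a prime *)

Section PolynomialRing.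
Variables (K : fieldType) (n p : nat).
Hypothesis charK : p \in [pchar K].
Local Notation S := {mpoly K[n]}.
Implicit Types (I J P : set S) (x g f h : S).

Lemma char_gt0 : (0 < p)%N.
Proof. exact: prime_gt0 (pcharf_prime charK). Qed.

Lemma char_gt1 : (1 < p)%N.
Proof. exact: prime_gt1 (pcharf_prime charK). Qed.

Lemma ideal_exp_neq0 I z N : I z -> z != 0 -> exists2 y, ideal_exp I N y & y != 0.
Proof. by move=> Iz z0; exists (z ^+ N); [exact: ideal_exp_X|exact: expf_neq0]. Qed.

(* Briancon-Skoda, in the form with as many extra powers as generators. *)
Lemma integral_closure_exp I (s : seq S) z N : I = gens s -> I z -> z != 0 ->
  integral_closure (ideal_exp I (N + size s)) `<=` ideal_exp I N.
Proof.
move=> Es Iz z0 h Hh; have [y Iy y0] := ideal_exp_neq0 (N + size s) Iz z0.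
have [c c0 Hc] := integral_closure_almost (is_ideal_exp _ _) Iy y0 Hh.
have sz : (msize c <= p ^ msize c)%N by apply: ltnW; apply: ltn_expl; exact: char_gt1.
have [Phi [PhiL Phic]] := root_linear_unit_large charK c0 sz.
(* [Phi] sends c h^q to h, while c h^q lies in the q-th power of I^(N + mu), which pigeonhole places
   in the q-th Frobenius power of I^N. *)
rewrite -(mulr1 h) -Phic -PhiL.2; apply: (root_linear_frobenius_power _ PhiL) => //.
have H : (p ^ msize c * N + size s * (p ^ msize c).-1 <
    (N + size s) * p ^ msize c + p ^ msize c)%N.
  have : (0 < p ^ msize c)%N by rewrite expn_gt0 char_gt0.
  rewrite mulnDl (mulnC N) -addnA ltn_add2l; case: (p ^ _)%N => // q _ /=.
  by rewrite addnS ltnS; apply: leq_trans (leq_addr _ _); rewrite leq_mul2l leqnSn orbT.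
have := Hc (p ^ msize c)%N; rewrite ideal_exp_exp mulrC Es.
exact: (ideal_exp_sub_frobenius_power char_gt0 H).
Qed.

(** If the order were larger than [E], then x would lie in the q-th Frobenius power of P^(1) with q
    above deg x, and a functional sending x to 1 would put 1 in P^(1). *)
Lemma symbolic_power_cap P x : is_prime_ideal P -> P <> [set 0] -> x != 0 ->
  exists B, forall l, symbolic_power P l%:Z x -> (l <= B)%N.
Proof.
move=> primeP P0 x0; pose e := msize x; pose E := (p ^ e * (1 + height P))%N.
exists E => l Hl; rewrite leqNgt; apply/negP => El.
have sz : (msize x <= p ^ e)%N by apply: ltnW; apply: ltn_expl; exact: char_gt1.
have [Phi [PhiL Phix]] := root_linear_unit_large charK x0 sz.
have : frobenius_power p (symbolic_power P 1%:Z) e x.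
  apply: (symbolic_power_frobenius (regular_tower_mpoly K n) primeP P0 char_gt0
    (has_root_duals_mpoly charK e) (leq_addr _ _)).
  exact: symbolic_power_le (ltnW El) _ Hl.
move=> /(root_linear_frobenius_power (is_ideal_symbolic_power _ primeP) PhiL).
rewrite Phix symbolic_powerE //; have /is_prime_idealP[idP _ _] := primeP.
by rewrite ideal_exp1 // => -[s Ps]; rewrite mulr1.
Qed.

End PolynomialRing.

(** * The exponents e_k as linear functions of sigma *)

Section Exponents.
Variables (K : fieldType) (n p m : nat).
Hypothesis charK : p \in [pchar K].
Local Notation S := {mpoly K[n]}.
Variable P : 'I_m -> set S.
Hypothesis P_prime : forall k, is_prime_ideal (P k).
Hypothesis P_neq0 : forall k, P k <> [set 0].
Implicit Types (sigma tau : 'rV[nat]_m) (k : 'I_m).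

Lemma is_ideal_Isigma sigma : is_ideal (Isigma P sigma).
Proof.
by apply: big_ind => [|I J _ _|k _]; [exact: is_ideal_setT|exact: is_ideal_mul|].
Qed.
Hint Resolve is_ideal_Isigma : core.

Lemma Isigma0 : Isigma P 0 = setT.
Proof.
apply: (big_ind (fun I => I = setT)) => [//|I J -> ->|k _]; last by rewrite mxE.
exact: ideal_mulT.
Qed.

Lemma IsigmaD sigma tau :
  Isigma P (sigma + tau) = ideal_mul (Isigma P sigma) (Isigma P tau).
Proof.
rewrite /Isigma; apply: (big_rec3 (fun I J L => L = ideal_mul I J)).
  by rewrite ideal_mulT.
by move=> k I J L _ ->; rewrite mxE ideal_expD ideal_mulACA.
Qed.

Lemma IsigmaMn sigma N : Isigma P (sigma *+ N) = ideal_exp (Isigma P sigma) N.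
Proof. by elim: N => [|N IH]; rewrite ?mulr0n ?Isigma0 // mulrS IsigmaD IH. Qed.

Lemma Isigma_neq0 sigma : exists2 z, Isigma P sigma z & z != 0.
Proof.
apply: (big_ind (fun I : set S => exists2 z, I z & z != 0)) => [|I J|k _].
- by exists 1; rewrite ?oner_eq0.
- by move=> [x Ix x0] [y Jy y0]; exists (x * y); [exact: ideal_mul_mem|exact: mulf_neq0].
have [z Pz z0] : exists2 z, P k z & z != 0.
  apply: contrapT => H; apply: (P_neq0 (k := k)); apply/seteqP; split=> [z Pz|_ ->].
    by apply: contrapT => /eqP z0; apply: H; exists z.
  by have /is_prime_idealP[idP _ _] := P_prime k; exact: ideal_0.
exact: ideal_exp_neq0 Pz z0.
Qed.

(** A nonzero element of I^sigma has bounded order along P_k, so the maximum exists and the default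
    of [nat_max] does not interfere. The witness [x] has exact order e_k(sigma). *)
Lemma esigmaP sigma k : Isigma P sigma `<=` symbolic_power (P k) (esigma P sigma 0 k)%:Z /\
  exists2 x, Isigma P sigma x & ~ symbolic_power (P k) (esigma P sigma 0 k).+1%:Z x.
Proof.
have [z Iz z0] := Isigma_neq0 sigma.
have [B HB] := symbolic_power_cap charK (P_prime k) (P_neq0 (k := k)) z0.
rewrite mxE; set X := [set l | _].
have [] := @nat_maxP X B; last first.
- move=> XM Xmax; split=> //; apply: contrapT => H.
  have /Xmax : X (nat_max X).+1; last by rewrite ltnn.
  by move=> x Ix; apply: contrapT => Hx; apply: H; exists x.
- by move=> l /(_ z Iz); exact: HB.
by exists 0%N => x _; rewrite symbolic_powerE //; exact: saturation_sub.
Qed.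

Lemma esigmaD sigma tau k :
  esigma P (sigma + tau) 0 k = (esigma P sigma 0%R k + esigma P tau 0%R k)%N.
Proof.
have [sub1 [x Ix Nx]] := esigmaP sigma k; have [sub2 [y Iy Ny]] := esigmaP tau k.
have [sub3 [z Iz Nz]] := esigmaP (sigma + tau) k.
apply/eqP; rewrite eqn_leq; apply/andP; split; rewrite leqNgt; apply/negP => lt.
  have Ixy : Isigma P (sigma + tau) (x * y) by rewrite IsigmaD; exact: ideal_mul_mem.
  have := symbolic_power_le (P_prime k) lt (sub3 _ Ixy).
  by case/(symbolic_power_prime (regular_tower_mpoly K n) (P_prime k) (sub1 _ Ix) (sub2 _ Iy)).
apply: Nz; apply: symbolic_power_le lt _ _ => //; move: z Iz; rewrite IsigmaD.
apply: ideal_mul_min => [|a b Ia Ib]; first exact: is_ideal_symbolic_power.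
by apply: symbolic_powerM => //; [exact: sub1|exact: sub2].
Qed.

Lemma esigma0 k : esigma P 0 0 k = 0%N.
Proof. by apply/eqP; rewrite -(eqn_add2l (esigma P 0 0 k)) -esigmaD addr0 addn0. Qed.

Lemma esigma_sum (T : Type) (r : seq T) (F : T -> 'rV[nat]_m) k :
  esigma P (\sum_(i <- r) F i) 0 k = (\sum_(i <- r) esigma P (F i) 0%R k)%N.
Proof.
by apply: (big_morph (fun s => esigma P s 0 k)) => [s t|]; [exact: esigmaD|exact: esigma0].
Qed.

Lemma esigmaMn sigma N k : esigma P (sigma *+ N) 0 k = (N * esigma P sigma 0%R k)%N.
Proof. by elim: N => [|N IH]; rewrite ?mulr0n ?esigma0 // mulrS esigmaD IH. Qed.

(** Linearity turns the rounding of exponent vectors into an error measured on unit vectors. *)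
Lemma esigma_delta sigma k :
  esigma P sigma 0 k = (\sum_(j < m) sigma 0%R j * esigma P (delta_mx 0%R j) 0%R k)%N.
Proof.
have {1}-> : sigma = \sum_(j <- index_enum 'I_m) delta_mx 0 j *+ sigma 0 j.
  apply/rowP => j; rewrite summxE (bigD1 j) //= big1 ?addr0.
    by rewrite mulmxnE !mxE !eqxx mulr1n natn.
  by move=> i ij; rewrite mulmxnE !mxE eq_sym (negPf ij) andbF mul0rn.
by rewrite esigma_sum; apply: eq_bigr => j _; rewrite esigmaMn.
Qed.

End Exponents.

(** * Test ideals *)

Section Numerics.
Variable R : realType.
Implicit Types (lambda w C : R).

Lemma absz_ceil_bounds (x : R) : 0 <= x ->
  x <= (absz (Num.ceil x))%:R :> R /\ (absz (Num.ceil x))%:R < x + 1.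
Proof.
move=> x0; have c0 : (0 <= Num.ceil x)%R by rewrite ceil_ge0; apply: lt_le_trans x0; rewrite ltrN10.
have -> : (absz (Num.ceil x))%:R = (Num.ceil x)%:~R :> R by rewrite -[in RHS](gez0_abs c0).
by split; [exact: ceil_ge|rewrite -ltrBlDr; have := ceilB1_lt x; rewrite intrB].
Qed.

(** Since N >= lambda q, E is at least q lambda w, hence at least q floor (lambda w) = q (l + h -
    1); q is added to both sides to avoid subtraction. *)
Lemma exponent_upper lambda w (q l h E : nat) : 0 < lambda -> 0 <= w ->
  (absz (Num.ceil (lambda * q%:R)))%:R * w <= E%:R ->
  Num.floor (lambda * w) + 1 - h%:Z = l%:Z -> (q * (l + h) <= E + q)%N.
Proof.
move=> lambda0 w0 HE El; rewrite -(ler_nat R).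
have [c1 _] := absz_ceil_bounds (mulr_ge0 (ltW lambda0) (ler0n R q)).
have Ef : (l + h)%:R = (Num.floor (lambda * w))%:~R + 1 :> R.
  have -> : (l + h)%:R = (l%:Z + h%:Z)%:~R :> R by rewrite intrD natrD.
  by rewrite -El subrK intrD.
rewrite natrM Ef natrD mulrDr mulr1 lerD2r; apply: le_trans HE.
apply: (@le_trans _ _ (q%:R * (lambda * w))); first by rewrite ler_wpM2l // floor_le.
by rewrite mulrA (mulrC q%:R) ler_wpM2r.
Qed.

(* The slack in [lambda w < floor (lambda w) + 1], multiplied by [q], absorbs
   every constant once [q] is large. *)
Lemma exponent_lower lambda w C (h mu : nat) : 0 < lambda -> 0 <= w ->
  exists e0 : nat, forall q E : nat, (e0 <= q)%N ->
  E%:R <= (absz (Num.ceil (lambda * q%:R)) + mu)%:R * w + C ->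
  E%:Z <= q%:Z * (Num.floor (lambda * w) + 1) - h%:Z.
Proof.
move=> lambda0 w0; set F := Num.floor (lambda * w).
pose d := F%:~R + 1 - lambda * w.
have d0 : 0 < d by rewrite subr_gt0; have := floorD1_gt (lambda * w); rewrite intrD.
(* In the numerator, 1 pays for the ceiling in N, mu for Briancon-Skoda, C for rounding vectors, and
   h for having f^(q-1) instead of f^q. *)
pose B := ((1 + mu%:R) * w + C + h%:R) / d.
exists (Num.bound `|B|) => q E qe HE.
have [_ c2] := absz_ceil_bounds (mulr_ge0 (ltW lambda0) (ler0n R q)).
rewrite -(ler_int R) intrB intrM intrD lerBrDr -!pmulrn.
have Bq : B <= q%:R.
  apply: le_trans (ler_norm B) _; apply: ltW; apply: lt_le_trans (archi_boundP (normr_ge0 B)) _.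
  by rewrite ler_nat.
have {}Bq : (1 + mu%:R) * w + C + h%:R <= q%:R * d by rewrite -ler_pdivrMr.
apply: le_trans (_ : (lambda * q%:R + 1 + mu%:R) * w + C + h%:R <= _).
  rewrite lerD2r; apply: le_trans HE _; rewrite lerD2r ler_wpM2r // natrD lerD2r.
  exact: ltW.
move: Bq; rewrite /d; move: (F%:~R : R) (q%:R : R) (mu%:R : R) (h%:R : R) => f' q' mu' h'.
by move=> H; nra.
Qed.

End Numerics.

Section FrobeniusRoots.
Variables (A : comNzRingType) (p : nat).
Implicit Types (I J L : set A).

Lemma is_ideal_frobenius_root I e : is_ideal (frobenius_root p I e).
Proof. by apply: is_ideal_bigcap => J [[]]. Qed.

Lemma frobenius_root_min I J e : is_ideal J -> I `<=` frobenius_power p J e ->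
  frobenius_root p I e `<=` J.
Proof. by move=> idJ IJ; apply: smallest_sub => // x. Qed.

Lemma frobenius_root_mem I e x :
  (forall J, is_ideal J -> I `<=` frobenius_power p J e -> J x) -> frobenius_root p I e x.
Proof. by move=> H J [[idJ IJ] _]; exact: H. Qed.

(** The threshold may depend on the generator; finitely many elements generate [L], so one threshold
    serves them all, and from there on the roots equal [L]. *)
Lemma test_idealE (R : realType) (lambda : R) I L : noetherian A -> is_ideal L ->
  let root e := frobenius_root p
    (ideal_exp I (absz (Num.ceil (lambda * (p ^ e)%:R)))) e in
  (forall e, root e `<=` L) ->
  (exists G, L = ideal_gen G /\
     forall x, G x -> exists e0, forall e, (e0 <= e)%N -> root e x) ->
  test_ideal p lambda I = L.
Proof.
move=> noethA idL root rootL [G [LG HG]].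
have LE x : L x -> exists e0, forall e, (e0 <= e)%N -> root e x.
  rewrite LG; apply: (@ideal_gen_min _ [set x | exists e0, forall e, (e0 <= e)%N -> root e x]).
    split=> /=.
    - by exists 0%N => e _; apply: ideal_0; exact: is_ideal_frobenius_root.
    - move=> y z [e1 H1] [e2 H2]; exists (maxn e1 e2) => e.
      rewrite geq_max => /andP[/H1 ? /H2 ?]; ideal_addT => //.
      exact: is_ideal_frobenius_root.
    - move=> a y [e1 H1]; exists e1 => e /H1 ?; ideal_mullT => //.
      exact: is_ideal_frobenius_root.
  exact: HG.
have [s Ls] := noethA L idL.
have [e0 He0] : exists e0, forall e, (e0 <= e)%N -> {in s, forall x, root e x}.
  have : {in s, forall x, L x} by move=> x xs; rewrite Ls; exact: gens_mem.
  elim: s {Ls} => [_|x s IH Hs]; first by exists 0%N.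
  have [y ys|e1 H1] := IH; first by apply: Hs; rewrite inE ys orbT.
  have [e2 H2] := LE x (Hs x (mem_head _ _)).
  exists (maxn e1 e2) => e; rewrite geq_max => /andP[/H1 H1e /H2 H2e] y.
  by rewrite inE => /orP[/eqP-> //|/H1e].
have stable e : (e0 <= e)%N -> root e = L.
  move=> /He0 Hs; apply/seteqP; split; first exact: rootL.
  by rewrite Ls; apply: gens_min => //; exact: is_ideal_frobenius_root.
apply: xget_unique; first by exists e0.
move=> J [e1 HJ]; rewrite -(HJ (maxn e0 e1)) ?leq_maxr //.
by apply: stable; exact: leq_maxl.
Qed.

End FrobeniusRoots.

Lemma ideal_gen_mul (A : comNzRingType) (G H L : set A) : is_ideal L ->
  (forall x y, G x -> H y -> L (x * y)) ->
  forall x y, ideal_gen G x -> ideal_gen H y -> L (x * y).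
Proof.
move=> idL GHL x y Gx Hy.
have half z : G z -> ideal_gen H `<=` [set w | L (z * w)].
  by move=> Gz; apply: ideal_gen_min; [exact: is_ideal_colon|move=> w; exact: GHL].
suff : ideal_gen G `<=` [set z | L (y * z)] by rewrite mulrC; apply.
apply: ideal_gen_min; first exact: is_ideal_colon.
by move=> z /half/(_ y Hy) /=; rewrite mulrC.
Qed.

(** * The two inclusions in general form, and the case of one exponent vector *)

Section TestIdealFormula.
Variables (R : realType) (K : fieldType) (n p m : nat).
Hypothesis charK : p \in [pchar K].
Local Notation S := {mpoly K[n]}.
Variable P : 'I_m -> set S.
Hypothesis P_prime : forall k, is_prime_ideal (P k).
Hypothesis P_neq0 : forall k, P k <> [set 0].
Variable lambda : R.
Hypothesis lambda_gt0 : 0 < lambda.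
Implicit Types (sigma tau : 'rV[nat]_m) (k : 'I_m) (w : 'I_m -> R).

Let N (e : nat) : nat := absz (Num.ceil (lambda * (p ^ e)%:R)).
Let level w k : int := Num.floor (lambda * w k) + 1 - (height (P k))%:Z.
Let target w : set S := \bigcap_(k : 'I_m) symbolic_power (P k) (level w k).

Lemma is_ideal_target w : is_ideal (target w).
Proof. by apply: is_ideal_bigcap => k _; exact: is_ideal_symbolic_power. Qed.

(** Root functionals test membership one prime at a time, so the intersection causes no
    difficulty. *)
Lemma target_upper w sigma e : (forall k, 0 <= w k) ->
  (forall k, (N e)%:R * w k <= (esigma P sigma 0 k)%:R) ->
  Isigma P sigma `<=` frobenius_power p (target w) e.
Proof.
move=> w0 Hw x Ix; apply/(frobenius_powerP _ (has_root_duals_mpoly charK e)).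
  exact: is_ideal_target.
move=> phi phiL k _; have idk := is_ideal_symbolic_power (level w k) (P_prime k).
apply: (root_linear_frobenius_power idk phiL).
have [sub _] := esigmaP charK P_prime P_neq0 sigma k.
case El : (level w k) => [l|l]; last by apply: frobenius_power_full.
apply: (symbolic_power_frobenius (regular_tower_mpoly K n) (P_prime k) (P_neq0 (k := k))
  (char_gt0 charK) (has_root_duals_mpoly charK e) _ (sub _ Ix)).
exact: (exponent_upper lambda_gt0 (w0 k) (Hw k) El).
Qed.

(** The order along P_k is at least q level + (q - 1) h = q (floor (lambda w) + 1) - h, which is the
    bound of [exponent_lower]. *)
Lemma target_lower_exponent w (C : 'I_m -> R) (mu : nat) (f g : S) :
  (forall k, 0 <= w k) -> (\bigcap_(k : 'I_m) ideal_exp (P k) (height (P k))) f ->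
  target w g ->
  exists e0, forall e E, (e0 <= e)%N ->
  (forall k, (E k)%:R <= (N e + mu)%:R * w k + C k) ->
  (\bigcap_(k : 'I_m) symbolic_power (P k) (E k)%:Z) (g ^+ (p ^ e) * f ^+ (p ^ e).-1).
Proof.
move=> w0 Pf wg.
have [e0 He0] := choice (fun k => exponent_lower (C k) (height (P k)) mu lambda_gt0 (w0 k)).
exists (\max_k e0 k) => e E /bigmax_leqP He HE k _.
have qe : (e0 k <= p ^ e)%N.
  by apply: leq_trans (He k isT) _; apply: ltnW; apply: ltn_expl; exact: char_gt1 charK.
have := He0 k _ _ qe (HE k); have q_gt0 : (0 < p ^ e)%N by rewrite expn_gt0 (char_gt0 charK).
have fk : symbolic_power (P k) (height (P k) * (p ^ e).-1)%N%:Z (f ^+ (p ^ e).-1).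
  by apply: symbolic_powerX => //; apply: ideal_exp_symbolic => //; exact: Pf.
have := wg k I; rewrite /level; move: (Num.floor _) => F.
case El : (F + 1 - _) => [l|l] Hg HEk.
  have Hgq := symbolic_powerX (p ^ e) (P_prime k) Hg.
  apply: symbolic_power_le (symbolic_powerM (P_prime k) Hgq fk) => //.
  have EF : F + 1 = l%:Z + (height (P k))%:Z by rewrite -El subrK.
  move: HEk q_gt0; rewrite EF; move: (height _) (p ^ e)%N (E k) => h [//|q] E' HEk _ /=.
  rewrite -lez_nat; move: HEk; nia.
(* The level is negative here and [g] contributes nothing; the order (q - 1) h of the power of [f]
   suffices. *)
ideal_mullT; first exact: is_ideal_symbolic_power.
apply: symbolic_power_le fk => //.
move: HEk q_gt0 El; move: (height _) (p ^ e)%N (E k) => h [//|q] E' HEk _ El /=.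
by rewrite -lez_nat; move: HEk El; rewrite NegzE; nia.
Qed.

(** The last hypothesis isolates what A and A+ provide: for each M, exponents at most M w + C, with
    C independent of M, whose symbolic powers meet in elements integral over I^M. *)
Lemma target_lower (I : set S) z w (C : 'I_m -> R) (f g : S) le a :
  is_ideal I -> I z -> z != 0 ->
  (\bigcap_(k : 'I_m) ideal_exp (P k) (height (P k))) f ->
  term_order le -> is_initial_monomial le f a -> squarefree_monomial a ->
  (forall k, 0 <= w k) -> target w g ->
  (forall M, exists2 E : 'I_m -> nat, forall k, (E k)%:R <= M%:R * w k + C k &
     \bigcap_(k : 'I_m) symbolic_power (P k) (E k)%:Z `<=`
       integral_closure (ideal_exp I M)) ->
  exists e0, forall e, (e0 <= e)%N -> frobenius_root p (ideal_exp I (N e)) e g.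
Proof.
move=> idI Iz z0 Pf leT fa sqf w0 wg HI.
have [noeth _ _] := regular_tower_mpoly K n.
have [s Is] := noeth I idI.
have [e0 He0] := target_lower_exponent C (size s) w0 Pf wg.
exists e0 => e /He0 He; apply: frobenius_root_mem => J idJ IJ.
have [E HE sub] := HI (N e + size s)%N.
have := integral_closure_exp charK Is Iz z0 (sub _ (He E HE)).
move=> /IJ HJ; have [Phi [PhiL Phi1]] := root_linear_unit_squarefree charK e leT fa sqf.
by have := root_linear_frobenius_power idJ PhiL HJ; rewrite PhiL.2 Phi1 mulr1.
Qed.

Lemma test_ideal_Isigma sigma : conditionA P -> conditionB P ->
  test_ideal p lambda (Isigma P sigma) = target (fun k => (esigma P sigma 0 k)%:R).
Proof.
move=> cA [f [Pf [le [leT [a [fa sqf]]]]]]; set w := fun k => _.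
have w0 k : 0 <= w k by exact: ler0n.
have [noeth _ _] := regular_tower_mpoly K n.
have idI := is_ideal_Isigma P sigma.
apply: test_idealE => // [|e|]; first exact: is_ideal_target.
  apply: frobenius_root_min; first exact: is_ideal_target.
  rewrite -IsigmaMn; apply: target_upper => // k.
  by rewrite (esigmaMn charK) // natrM.
exists (target w); split; first by rewrite ideal_gen_id //; exact: is_ideal_target.
move=> g wg; have [z Iz z0] := Isigma_neq0 P_prime P_neq0 sigma.
(* For a single sigma the exponents of the M-th power are exactly M e_k(sigma), so there is no error
   term. *)
apply: (target_lower (C := fun=> 0) idI Iz z0 Pf leT fa sqf w0 wg) => M.
exists (fun k => esigma P (sigma *+ M) 0 k) => [k|].
  by rewrite (esigmaMn charK) // natrM addr0.
by rewrite -IsigmaMn cA.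
Qed.

End TestIdealFormula.

(** * Sums over a set of exponent vectors *)

Section TestIdealSum.
Variables (R : realType) (K : fieldType) (n p m : nat).
Hypothesis charK : p \in [pchar K].
Local Notation S := {mpoly K[n]}.
Variable P : 'I_m -> set S.
Hypothesis P_prime : forall k, is_prime_ideal (P k).
Hypothesis P_neq0 : forall k, P k <> [set 0].
Variable lambda : R.
Hypothesis lambda_gt0 : 0 < lambda.
Implicit Types (sigma tau : 'rV[nat]_m) (k : 'I_m) (Sigma : set 'rV[nat]_m).

Lemma Isigma_sub_ISigma Sigma sigma : Sigma sigma -> Isigma P sigma `<=` ISigma P Sigma.
Proof. by move=> Ss x Ix; apply: ideal_gen_mem; exists sigma. Qed.

Lemma ideal_exp_ISigma Sigma N : ideal_exp (ISigma P Sigma) N `<=`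
  ISigma P [set \sum_(sigma <- l) sigma | l in
    [set l : seq 'rV[nat]_m | size l = N /\ {in l, forall sigma, Sigma sigma}]].
Proof.
elim: N => [|N IH].
  move=> x _; apply: (@Isigma_sub_ISigma _ 0); last by rewrite Isigma0.
  by exists [::]; rewrite ?big_nil.
rewrite ideal_expS; apply: ideal_mul_min => [|x y Ix /IH]; first exact: is_ideal_gen.
apply: ideal_gen_mul Ix => [|a b [sigma Ss Ia] [_ [l [sl Sl] <-] Ib]].
  exact: is_ideal_gen.
apply: (@Isigma_sub_ISigma _ (\sum_(s <- sigma :: l) s)).
  exists (sigma :: l) => //; split=> /=; first by rewrite sl.
  by move=> t; rewrite inE => /orP[/eqP->|/Sl].
by rewrite big_cons IsigmaD; exact: ideal_mul_mem.
Qed.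

Lemma PSigma_ge0 Sigma v k : PSigma P Sigma v -> 0 <= v 0 k.
Proof.
move=> [r [c [x [Hx c0 _ ->]]]]; rewrite summxE; apply: sumr_ge0 => i _.
rewrite mxE; apply: mulr_ge0 => //; have [s _ <-] := Hx i.
by rewrite mxE ler0n.
Qed.

(** By additivity the mean of the e(sigma) over [l] is a point whose summand can receive the product
    of the I^sigma over [l]. *)
Lemma PSigma_mean Sigma (l : seq 'rV[nat]_m) : l != [::] ->
  {in l, forall sigma, Sigma sigma} ->
  exists2 v, PSigma P Sigma v &
  forall k, (size l)%:R * v 0 k = (esigma P (\sum_(sigma <- l) sigma) 0 k)%:R.
Proof.
move=> l0 Sl; have N0 : (size l)%:R != 0 :> rat by rewrite pnatr_eq0 size_eq0.
exists (\sum_(i < size l) (size l)%:R^-1 *: natQ (esigma P (nth 0 l i))).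
  exists (size l), (fun=> (size l)%:R^-1), (fun i => natQ (esigma P (nth 0 l i))).
  split=> // [i|i|].
  - by exists (nth 0 l i) => //; apply: Sl; exact: mem_nth.
  - by rewrite invr_ge0 ler0n.
  - by rewrite sumr_const card_ord -[LHS]mulr_natr mulVf.
move=> k; rewrite summxE big_distrr /= (esigma_sum charK) //.
rewrite (big_nth 0) big_mkord natr_sum; apply: eq_bigr => i _.
by rewrite !mxE mulVKf.
Qed.

(** Rounding up moves each coordinate by less than 1, and e_k is linear, so the error is at most the
    sum of its values on unit vectors, whatever M is. *)
Lemma esigma_ceil (r : nat) (c : 'I_r -> rat) (sigma : 'I_r -> 'rV[nat]_m) M k :
  (forall i, 0 <= c i) ->
  (esigma P (ceilQ (\sum_i c i *: natQ (sigma i *+ M))) 0 k)%:R <=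
  M%:R * (\sum_i c i * (esigma P (sigma i) 0 k)%:R) +
  \sum_(j < m) (esigma P (delta_mx 0 j) 0 k)%:R :> rat.
Proof.
move=> c0; rewrite (esigma_delta charK) // natr_sum.
pose eps j : rat := (esigma P (delta_mx 0 j) 0 k)%:R.
pose u j : rat := \sum_i c i * (M%:R * (sigma i 0 j)%:R).
have u0 j : 0 <= u j.
  by apply: sumr_ge0 => i _; do 2!(apply: mulr_ge0 => //); rewrite ler0n.
have -> : M%:R * (\sum_i c i * (esigma P (sigma i) 0 k)%:R) = \sum_j u j * eps j.
  rewrite big_distrr /= (eq_bigr (fun i => \sum_j c i * (M%:R * (sigma i 0 j)%:R) * eps j)).
    by rewrite exchange_big /=; apply: eq_bigr => j _; rewrite /u big_distrl.
  move=> i _; rewrite (esigma_delta charK) // natr_sum !big_distrr /=.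
  by apply: eq_bigr => j _; rewrite natrM /eps; ring.
rewrite -big_split /=; apply: ler_sum => j _.
rewrite natrM -/(eps j) -[X in _ <= _ + X]mul1r -mulrDl.
apply: ler_wpM2r; first exact: ler0n.
rewrite mxE; have -> : (\sum_i c i *: natQ (sigma i *+ M)) 0 j = u j.
  rewrite summxE; apply: eq_bigr => i _; rewrite !mxE mulmxnE.
  have -> : sigma i 0 j *+ M = (M * sigma i 0%R j)%N by rewrite mulnC -mulr_natr natn.
  by rewrite natrM.
have c0' : (0 <= Num.ceil (u j))%R.
  by rewrite ceil_ge0; apply: lt_le_trans (u0 j); rewrite ltrN10.
have -> : (absz (Num.ceil (u j)))%:R = (Num.ceil (u j))%:~R :> rat.
  by rewrite -[in RHS](gez0_abs c0').
by apply: ltW; rewrite -ltrBlDr; have := ceilB1_lt (u j); rewrite intrB.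
Qed.

Lemma test_ideal_ISigma Sigma : conditionAplus P -> conditionB P ->
  test_ideal p lambda (ISigma P Sigma) =
  ideal_sum (PSigma P Sigma) (fun v => \bigcap_(k : 'I_m) symbolic_power (P k)
    (Num.floor (lambda * ratr (v 0 k)) + 1 - (height (P k))%:Z)).
Proof.
move=> cA [f [Pf [le [leT [a [fa sqf]]]]]].
have [noeth _ _] := regular_tower_mpoly K n.
apply: test_idealE => // [|e|]; first exact: is_ideal_gen.
  apply: frobenius_root_min; first exact: is_ideal_gen.
  apply: subset_trans (@ideal_exp_ISigma _ _) _.
  apply: ideal_gen_min => // x [_ [l [sl Sl] <-] Ix].
  (* A positive lambda makes N positive, so the list [l] is nonempty and has a mean. *)
  have N_gt0 : (0 < absz (Num.ceil (lambda * (p ^ e)%:R)))%N.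
    rewrite absz_gt0 gt_eqF // ceil_gt0 mulr_gt0 // ltr0n expn_gt0.
    by rewrite (char_gt0 charK).
  have l0 : l != [::] by rewrite -size_eq0 sl -lt0n.
  have [v Pv Ev] := PSigma_mean l0 Sl.
  apply: frobenius_power_mono (target_upper charK P_prime P_neq0 lambda_gt0
    (w := fun k => ratr (v 0 k)) _ _ Ix).
  - by move=> y Hy; apply: ideal_gen_mem; exists v.
  - by move=> k; rewrite ler0q; exact: PSigma_ge0 Pv.
  - move=> k; rewrite -sl; have := congr1 (@ratr R) (Ev k).
    by rewrite rmorphM /= !ratr_nat => ->.
eexists; split; first by [].
move=> g [v Pv wg].
have w0 k : 0 <= ratr (v 0 k) :> R by rewrite ler0q; exact: PSigma_ge0 Pv.
have [r [c [x [Hx c0 c1 Ev]]]] := Pv.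
have /choice[sigma Hs] : forall i, exists s, Sigma s /\ natQ (esigma P s) = x i.
  by move=> i; have [s] := Hx i; exists s.
(* An empty combination would have coefficient sum 0. A point of Sigma is wanted to produce a
   nonzero element of the ideal. *)
have r_gt0 : (0 < r)%N.
  by case: (r) c c1 {Ev c0 Hx x Hs sigma} => // c; rewrite big_ord0 => /eqP; rewrite eq_sym oner_eq0.
have [z Iz z0] := Isigma_neq0 P_prime P_neq0 (sigma (Ordinal r_gt0)).
have {}Iz := Isigma_sub_ISigma (Hs _).1 Iz.
pose C k : R := ratr (\sum_(j < m) (esigma P (delta_mx 0 j) 0 k)%:R).
apply: (target_lower charK P_prime lambda_gt0 (w := fun k => ratr (v 0 k)) (C := C)
  (is_ideal_gen _) Iz z0 Pf leT fa sqf w0 wg) => M.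
exists (fun k => esigma P (ceilQ (\sum_i c i *: natQ (sigma i *+ M))) 0 k) => [k|].
  have := esigma_ceil sigma M k c0; rewrite -(ler_rat R) rmorphD rmorphM /= !ratr_nat.
  rewrite Ev summxE; congr (_ <= _ * ratr _ + _); apply: eq_bigr => i _.
  by rewrite [RHS]mxE -(Hs i).2 [natQ _ 0 k]mxE.
(* A+ is applied to the multiples M sigma: their hull contains the M-fold dilation of the chosen
   convex combination, and the ideal of [Sigma'] lies in the M-th power of that of [Sigma]. *)
pose Sigma' := [set sigma *+ M | sigma in Sigma].
have sub : ISigma P Sigma' `<=` ideal_exp (ISigma P Sigma) M.
  apply: ideal_gen_min => // y [_ [s Ss <-]].
  by rewrite IsigmaMn; apply: ideal_exp_mono; exact: Isigma_sub_ISigma.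
move=> y Hy; apply: (integral_closure_mono sub); rewrite cA; apply: ideal_gen_mem.
exists (\sum_i c i *: natQ (sigma i *+ M)) => //.
exists r, c, (fun i => natQ (sigma i *+ M)); split=> // i.
by exists (sigma i *+ M) => //; exists (sigma i) => //; exact: (Hs i).1.
Qed.

End TestIdealSum.

Theorem theorem2p1 (R : realType) (K : fieldType) (p : nat)
    (charK : p \in [pchar K]) (n m : nat) (m_gt0 : (0 < m)%N)
    (P : 'I_m -> set {mpoly K[n]})
    (P_prime : forall k, is_prime_ideal (P k))
    (P_neq0 : forall k, P k <> [set 0])
    (P_homog : forall k, is_homogeneous (P k)) :
  (conditionA P -> conditionB P ->
   forall (lambda : R) (sigma : 'rV[nat]_m), 0 < lambda ->
     test_ideal p lambda (Isigma P sigma) =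
     \bigcap_(k : 'I_m)
       symbolic_power (P k)
         (Num.floor (lambda * (esigma P sigma 0 k)%:R) + 1
            - (height (P k))%:Z))
  /\
  (conditionAplus P -> conditionB P ->
   forall (lambda : R) (Sigma : set 'rV[nat]_m), 0 < lambda ->
     test_ideal p lambda (ISigma P Sigma) =
     ideal_sum (PSigma P Sigma)
       (fun v => \bigcap_(k : 'I_m)
          symbolic_power (P k)
            (Num.floor (lambda * ratr (v 0 k)) + 1 - (height (P k))%:Z))).
Proof.
split=> [cA cB lambda sigma lambda0|cA cB lambda Sigma lambda0].
  exact: (test_ideal_Isigma charK P_prime P_neq0 lambda0 sigma cA cB).
exact: (test_ideal_ISigma charK P_prime P_neq0 lambda0 Sigma cA cB).
Qed.
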